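(* For every real number $r\ge1$ there exist a compact interval $[a,b]\subset\mathbb R$ (with $a<b$) and a function $f\colon[a,b]\to\mathbb R$ such that $f$ is HK$_r$-integrable on $[a,b]$ and, for every real number $s\ge1$, $f$ is not P$_s$-integrable on $[a,b]$.
   Context: Throughout, $[a,b]\subset\mathbb R$ is a compact interval with $a<b$, and $r\ge1$, $s\ge 1$ are real numbers. A function in $L^r[a,b]$ here means an everywhere-defined (finite real-valued) Lebesgue measurable function $F\colon[a,b]\to\mathbb R$ with $\int_a^b|F|^r<\infty$; its values at individual points matter. Write $[w]_+=\max\{w,0\}$. ''Nearly everywhere'' means everywhere except on a countable set; ''almost everywhere'' is with respect to Lebesgue measure. **$L^r$-derivative.** $F\in L^r[a,b]$ is $L^r$-differentiable at $x\in(a,b)$ with $L^r$-derivative $F_r'(x)=\alpha\in\mathbb R$ if $$\left(\frac1h\int_{-h}^{h}|F(x+t)-F(x)-\alpha t|^r\,dt\right)^{1/r}=o(h)\quad\text{as }h\to0^+.$$ At $x=a$ the integral is taken over $[0,h]$, and at $x=b$ over $[-h,0]$. **HK$_r$-integrability.** (The following descriptive characterization of $L^r$-Henstock–Kurzweil integrability is used as the definition.) A function $f\colon[a,b]\to\mathbb R$ is HK$_r$-integrable if there exist $F\in L^r[a,b]$ and a set $E\subset[a,b]$ of Lebesgue measure zero such that: (i) $F$ is $L^r$-differentiable with $F_r'(x)=f(x)$ at every $x\in[a,b]\setminus E$; (ii) $F$ has the AC$_r$ property on $E$: for every $\varepsilon>0$ there is a function $\delta\colon E\to(0,\infty)$ such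 that whenever $[c_1,d_1],\dots,[c_n,d_n]$ are nonoverlapping nondegenerate subintervals of $[a,b]$ and for each $i$ there is a point $x_i\in E\cap[c_i,d_i]$ with $[c_i,d_i]\subset(x_i-\delta(x_i),x_i+\delta(x_i))$, one has, for these points $x_i$, $$\sum_{i=1}^n\left(\frac1{d_i-c_i}\int_{c_i}^{d_i}|F(y)-F(x_i)|^r\,dy\right)^{1/r}<\varepsilon.$$ **$L^s$-continuity.** $F\in L^s[a,b]$ is $L^s$-continuous at $x\in(a,b)$ if $\left(\frac1h\int_{-h}^h|F(x+t)-F(x)|^s\,dt\right)^{1/s}\to0$ as $h\to0^+$; at $a$ the integral is over $[0,h]$ and at $b$ over $[-h,0]$. **$L^s$-derivates.** For $F\in L^s[a,b]$ and $x\in[a,b)$, the upper-right $L^s$-derivate $D_s^+F(x)$ is the infimum of all real $\alpha$ such that $$\left(\frac1h\int_0^h[F(x+t)-F(x)-\alpha t]_+^s\,dt\right)^{1/s}=o(h)\quad\text{as }h\to0^+,$$ with $D_s^+F(x)=+\infty$ if no such real $\alpha$ exists. For $x\in(a,b]$, the upper-left $L^s$-derivate $D_s^-F(x)$ is the infimum of all real $\alpha$ such that $$\left(\frac1h\int_0^h[F(x)-F(x-t)-\alpha t]_+^s\,dt\right)^{1/s}=o(h)\quad\text{as }h\to0^+,$$ with value $+\infty$ if no such real $\alpha$ exists. The upper $L^s$-derivate is $\overline D_sF(x)=\max\{D_s^+F(x),D_s^-F(x)\}$ for $x\in(a,b)$, $\overline D_sF(a)=D_s^+F(a)$, $\overline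 D_sF(b)=D_s^-F(b)$. **P$_s$-integrability.** A function $m\in L^s[a,b]$ is an $L^s$-minor function of $f\colon[a,b]\to\mathbb R$ if: $m(a)=0$; $m$ is $L^s$-continuous at every point of $[a,b]$; $\overline D_sm(x)\le f(x)$ for almost every $x\in[a,b]$; and $\overline D_sm(x)<\infty$ nearly everywhere in $[a,b]$. A function $M$ is an $L^s$-major function of $f$ if $-M$ is an $L^s$-minor function of $-f$. The function $f$ is P$_s$-integrable ($L^s$-Perron integrable) on $[a,b]$ if for every $\varepsilon>0$ there are an $L^s$-major function $M$ and an $L^s$-minor function $m$ of $f$ with $M(b)-m(b)<\varepsilon$. *)

(* Defs.v *)
From HB Require Import structures.
From mathcomp Require Import all_boot all_order all_algebra.
From mathcomp Require Import all_classical all_reals all_analysis.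

Set Implicit Arguments.
Unset Strict Implicit.
Unset Printing Implicit Defensive.

Import Order.TTheory GRing.Theory Num.Theory.
Import numFieldNormedType.Exports.

Local Open Scope classical_set_scope.
Local Open Scope ring_scope.

(* A function on [a, b] is encoded by a total function R -> R of which only the
   restriction to [a, b] matters: every integral below is either over a subset
   of [a, b] or is used only in the limit h -> 0+ of a window shrinking to a
   point of [a, b] (one-sided at the endpoints). *)

(* The Lebesgue (as opposed to Borel) measurable space on R: the carrier of
   completed_lebesgue_measure. *)
Definition lebesgueR (R : realType) : measurableType _ :=
  caratheodory_type ((wlength (@idfun R))^* )%mu.

Definition leb (R : realType) : {measure set (lebesgueR R) -> \bar R} :=
  @completed_lebesgue_measure R.

Definition memL (R : realType) (r a b : R) (F : R -> R) : Prop :=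
  measurable_fun (`[a, b] : set (lebesgueR R)) (F : lebesgueR R -> R) /\
  (\int[leb R]_(x in `[a, b]) (`|F x| `^ r)%:E < +oo)%E.

(* ((1/l) * \int_D g^r)^(1/r), for g >= 0.  Rintegral is 0 when the integral is
   infinite; this does not happen below, since F is always required to
   satisfy memL on [a, b] and the domains lie in [a, b] (for small h). *)
Definition meanpow (R : realType) (r l : R) (D : set R) (g : R -> R) : R :=
  (l^-1 * \int[leb R]_(t in D) (g t `^ r)) `^ r^-1.

Definition window (R : realType) (a b x h : R) : set R :=
  if x == a then `[0, h]%classic
  else if x == b then `[- h, 0]%classic
  else `[- h, h]%classic.

Definition Lderiv_at (R : realType) (r a b : R) (F : R -> R) (x alpha : R)
    : Prop :=
  (fun h => meanpow r h (window a b x h)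
              (fun t => `|F (x + t) - F x - alpha * t|)) =o_ (0^'+) id.

Definition AC_on (R : realType) (r a b : R) (F : R -> R) (E : set R) : Prop :=
  forall eps : R, 0 < eps ->
  exists delta : R -> R,
    (forall x, E x -> 0 < delta x) /\
    forall (n : nat) (c d x : 'I_n -> R),
      (forall i, [/\ a <= c i, c i < d i & d i <= b]) ->
      trivIset setT (fun i => `]c i, d i[%classic) ->
      (forall i, E (x i) /\ c i <= x i <= d i) ->
      (forall i, `[c i, d i] `<=`
                 `]x i - delta (x i), x i + delta (x i)[) ->
      \sum_(i < n) meanpow r (d i - c i) `[c i, d i]
                     (fun y => `|F y - F (x i)|) < eps.

Definition HK_integrable (R : realType) (r a b : R) (f : R -> R) : Prop :=
  exists (F : R -> R) (E : set R),
    [/\ memL r a b F,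
        E `<=` `[a, b] /\ (leb R).-negligible (E : set (lebesgueR R)),
        forall x, (`[a, b] `\` E) x -> Lderiv_at r a b F x (f x) &
        AC_on r a b F E].

Definition Lcontinuous_at (R : realType) (s a b : R) (F : R -> R) (x : R)
    : Prop :=
  meanpow s h (window a b x h) (fun t => `|F (x + t) - F x|) @[h --> 0^'+]
    --> 0.

(* ereal_inf of the empty set is +oo. *)
Definition upper_right_derivate (R : realType) (s : R) (F : R -> R) (x : R)
    : \bar R :=
  ereal_inf [set alpha%:E | alpha in [set alpha : R |
    (fun h => meanpow s h `[0, h]
                (fun t => Num.max (F (x + t) - F x - alpha * t) 0))
    =o_ (0^'+) id]].

Definition upper_left_derivate (R : realType) (s : R) (F : R -> R) (x : R)
    : \bar R :=
  ereal_inf [set alpha%:E | alpha in [set alpha : R |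
    (fun h => meanpow s h `[0, h]
                (fun t => Num.max (F x - F (x - t) - alpha * t) 0))
    =o_ (0^'+) id]].

Definition upper_derivate (R : realType) (s a b : R) (F : R -> R) (x : R)
    : \bar R :=
  if x == a then upper_right_derivate s F x
  else if x == b then upper_left_derivate s F x
  else Order.max (upper_right_derivate s F x) (upper_left_derivate s F x).

Definition minor_function (R : realType) (s a b : R) (f m : R -> R) : Prop :=
  [/\ memL s a b m,
      m a = 0,
      forall x, `[a, b]%classic x -> Lcontinuous_at s a b m x,
      {ae leb R, forall x : lebesgueR R,
         `[a, b]%classic x -> (upper_derivate s a b m x <= (f x)%:E)%E} &
      exists2 C : set R, countable C &
        forall x, (`[a, b] `\` C) x -> (upper_derivate s a b m x < +oo)%E].

Definition major_function (R : realType) (s a b : R) (f M : R -> R) : Prop :=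
  minor_function s a b (fun x => - f x) (fun x => - M x).

Definition P_integrable (R : realType) (s a b : R) (f : R -> R) : Prop :=
  forall eps : R, 0 < eps ->
  exists M m : R -> R,
    [/\ major_function s a b f M, minor_function s a b f m &
        M b - m b < eps].

(* Main.v *)
Require Import Defs.
From mathcomp Require Import all_boot all_order all_algebra.
From mathcomp Require Import all_classical all_reals all_analysis.
From mathcomp Require Import measurable_realfun zify ring lra.

(** Why the theorem is true.

Let P be a null Cantor set in [0, 1] whose construction intervals of stage k
have a length L k that decreases extremely fast.  In the middle of every gap of
stage k stands a smooth spike of height 1 and half-width L k.+1; the function F
is the sum of these spikes and f is its derivative off P.

F is an HK_r primitive of f with exceptional set P (spikes_HK).  Off P it is
differentiable.  For the AC_r property let I be an interval that contains a
point of P and meets a spike of stage k but none of a smaller stage.  Between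
that spike and the point of P, I covers a quarter of a construction interval of
stage k, whereas F lives on a part of I of measure at most 2^(k+2) L k.+1.  The
r-mean of F over I is then at most 8^-k, hence at most
8^-k (8 / L k) |I \cap V k|, where V k is the union of the stage k intervals
(interval_mean_le).  For disjoint intervals I the measures |I \cap V k| add up
to at most |V k| <= 2^k L k, and what remains is the tail of a geometric series
(spikes_AC).

Let now M be an L^s-major and m an L^s-minor function of f.  Since
t <= c + c (t / c)^s, all conditions on M and m imply their versions in the mean
of order 1 (minor_function_L1).  A monotonicity theorem for functions that are
continuous in the mean, based on right derivates (L1_nonincreasing), shows that M - m is nondecreasing on [0, 1] and that M - F is
nondecreasing on every gap of P.  The right derivates of m and of - M are less
than +oo on P up to a countable set, so by the Baire category theorem one and
the same bound n works at a set of points that is dense in the part of P in some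
cylinder (cantor_baire_countable).  In a construction interval of stage k of that
cylinder, take such a point x to the left of the middle gap.  The bound for m
over a window of length comparable with L k says that the total excess of m over
m x on the window is at most (L k)^2; the core of the spike has width L k.+1, so
at some point y of the core m y exceeds m x by at most a multiple of
(L k)^2 / L k.+1, which tends to 0.  In the same way M z is hardly below M x for
some z between x and the spike, and from z to y the function M rises at least
as much as F, that is by 1/2.  So M - m grows by at least 1/4 in every small
construction interval (jump_in_cylinder).  Infinitely many of these are
disjoint, and M - m would be unbounded (not_both_minor). *)

Set Implicit Arguments.
Unset Strict Implicit.
Unset Printing Implicit Defensive.

Import Order.TTheory GRing.Theory Num.Theory.
Import numFieldNormedType.Exports.

Local Open Scope classical_set_scope.
Local Open Scope ring_scope.

(** * Lebesgue measure on intervals and translations *)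

Notation itg c d g := ((leb _).-integrable `[c, d]%classic (EFin \o g)).
Notation Int c d g := (Rintegral (leb _) `[c, d]%classic g).

Lemma borel_leb (R : realType) (A : set R) :
  measurable A -> measurable (A : set (lebesgueR R)).
Proof. exact: sub_caratheodory. Qed.

Lemma borel_fun_leb (R : realType) (D : set R) (g : R -> R) :
  measurable D -> measurable_fun D g ->
  measurable_fun (D : set (lebesgueR R)) (g : lebesgueR R -> R).
Proof. by move=> mD mg _ Y mY; apply: borel_leb; exact: mg. Qed.

Lemma measurable_cc (R : realType) (c d : R) :
  measurable (`[c, d]%classic : set (lebesgueR R)).
Proof. by apply: borel_leb; exact: measurable_itv. Qed.

Lemma leb_cc (R : realType) (c d : R) : c <= d -> leb R `[c, d]%classic = (d - c)%:E.
Proof.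
move=> cd; have -> : leb R `[c, d]%classic = lebesgue_measure `[c, d]%classic by [].
rewrite lebesgue_measure_itv/= lte_fin; case: ltP => // dc.
by have -> : c = d; [apply/eqP; rewrite eq_le cd|rewrite subrr].
Qed.

Lemma leb_oo (R : realType) (c d : R) : c <= d -> leb R `]c, d[%classic = (d - c)%:E.
Proof.
move=> cd; have -> : leb R `]c, d[%classic = lebesgue_measure `]c, d[%classic by [].
rewrite lebesgue_measure_itv/= lte_fin; case: ltP => // dc.
by have -> : c = d; [apply/eqP; rewrite eq_le cd|rewrite subrr].
Qed.

(** The outer measure is an infimum over open supersets, and for open sets
translation invariance follows from the uniqueness of Lebesgue measure on
Borel sets. *)
Lemma leb_shift_le (R : realType) (t : R) (A : set R) :
  (leb R ((fun x => x + t)%R @^-1` A) <= leb R A)%E.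
Proof.
rewrite [leRHS](outer_measure_open A).
apply: le_ereal_inf_tmp => _ [U [oU AU] <-].
have mU : measurable U by exact: open_measurable.
have mt : measurable_fun (setT : set R) (fun x : R => x + t).
  by apply: measurable_funD => //; exact: measurable_cst.
apply: (@le_trans _ _ (lebesgue_measure ((fun x : R => x + t) @^-1` U))).
  by apply: le_outer_measure => x; apply: AU.
have -> : (wlength (@idfun R))^*%mu U = lebesgue_measure U by [].
rewrite [leRHS](@lebesgue_measure_unique R (pushforward lebesgue_measure
  (fun x : measurableTypeR R => (x + t : measurableTypeR R))))//.
move=> _ [[a b] _ <-] /=.
rewrite /pushforward.
have -> : (fun x => x + t) @^-1` `]a, b]%classic = `]a - t, b - t]%classic.
  by apply/seteqP; split => x /=; rewrite !in_itv/= ltrBlDr lerBrDr.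
rewrite !lebesgue_measure_itv/= !lte_fin ltrD2r; case: ifP => // _.
by rewrite -!EFinD; congr (_%:E); lra.
Qed.

Lemma leb_shift (R : realType) (t : R) (A : set R) :
  leb R ((fun x => x + t)%R @^-1` A) = leb R A.
Proof.
apply/eqP; rewrite eq_le leb_shift_le/=.
apply: le_trans (leb_shift_le (- t) _).
by rewrite -comp_preimage; apply: le_outer_measure => x/=; rewrite subrK.
Qed.

Lemma measurable_lebP (R : realType) (A : set R) :
  measurable (A : set (lebesgueR R)) <->
  forall X : set R, leb R X = (leb R (X `&` A) + leb R (X `&` ~` A))%E.
Proof. by []. Qed.

(** Measurability is the Caratheodory condition, which is phrased with the outer
measure only, so it inherits the translation invariance of the latter. *)
Lemma measurable_shift (R : realType) (t : R) :
  measurable_fun (setT : set (lebesgueR R))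
    ((fun x : R => x + t) : lebesgueR R -> lebesgueR R).
Proof.
move=> _ Y /measurable_lebP mY; rewrite setTI; apply/measurable_lebP => X.
rewrite -(leb_shift (-t) X) -(leb_shift (-t) (X `&` _)).
rewrite -(leb_shift (-t) (X `&` ~` _)) mY.
by congr (leb R _ + leb R _)%E; apply/seteqP; split => x/=; rewrite ?subrK.
Qed.

Lemma Rintegral_leb_shift (R : realType) (t : R) (D : set R) (g : R -> R) :
  measurable (D : set (lebesgueR R)) ->
  measurable_fun (D : set (lebesgueR R)) (g : lebesgueR R -> R) ->
  (forall y, D y -> 0 <= g y) ->
  Rintegral (leb R) ((fun x => x + t) @^-1` D) (fun x => g (x + t)) =
  Rintegral (leb R) D g.
Proof.
move=> mD mg g0; congr fine.
rewrite -(@ge0_integral_pushforward _ _ _ _ _ _ (measurable_shift t)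
  (leb R) D (fun y => (g y)%:E))//.
- apply: eq_measure_integral; first exact: measurable_shift.
  by move=> ? A mA _; exact: (leb_shift t A).
- exact/measurable_EFinP.
- by move=> y /set_mem Dy; rewrite lee_fin g0.
Qed.

Section Toolkit.
Context {R : realType}.
Implicit Types (c d e k : R) (g : R -> R).

Lemma cc_sub c d c' d' : c <= c' -> d' <= d -> `[c', d']%classic `<=` `[c, d]%classic.
Proof. by move=> cc dd x /=; rewrite !in_itv/= => /andP[? ?]; apply/andP; split; lra. Qed.

Lemma itgS c d c' d' g : c <= c' -> d' <= d -> itg c d g -> itg c' d' g.
Proof.
move=> cc dd; apply: integrableS; try exact: measurable_cc.
exact: cc_sub.
Qed.

Lemma itg_bounded c d g k :
  measurable_fun (`[c, d]%classic : set (lebesgueR R)) (g : lebesgueR R -> R) ->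
  (forall y, c <= y <= d -> `|g y| <= k) -> itg c d g.
Proof.
move=> mg gk; have [dc|cd] := ltP d c.
  by rewrite set_itv_ge ?bnd_simp -?ltNge//; exact: integrable_set0.
apply: measurable_bounded_integrable => //; first exact: measurable_cc.
  by rewrite [X in (X < _)%E](_ : _ = (d - c)%:E) ?ltry//; exact: leb_cc.
exists k; split; first exact: num_real.
move=> M kM y; rewrite /= in_itv/= => ycd; exact: le_trans (gk _ ycd) (ltW kM).
Qed.

Lemma itg_cst c d k : itg c d (fun=> k).
Proof. by apply: (@itg_bounded _ _ _ `|k|) => //; exact: measurable_cst. Qed.

Lemma itgD c d g1 g2 : itg c d g1 -> itg c d g2 -> itg c d (fun y => g1 y + g2 y).
Proof.
by move=> i1 i2; apply: (integrableD (measurable_cc c d) i1 i2).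
Qed.

Lemma itgN c d g : itg c d g -> itg c d (fun y => - g y).
Proof. by move=> i1; exact: (integrableN i1). Qed.

Lemma itgB c d g1 g2 : itg c d g1 -> itg c d g2 -> itg c d (fun y => g1 y - g2 y).
Proof. by move=> i1 i2; exact: itgD (itgN i2). Qed.

Lemma itg_meas c d g : itg c d g ->
  measurable_fun (`[c, d]%classic : set (lebesgueR R)) (g : lebesgueR R -> R).
Proof. by case/integrableP => /measurable_EFinP. Qed.

Lemma itg_abs c d g : itg c d g -> itg c d (fun y => `|g y|).
Proof. move=> i1. exact: (integrable_abse i1). Qed.

Lemma itg_pos c d g : itg c d g -> itg c d (fun y => Num.max (g y) 0).
Proof.
move=> i1; apply: (le_integrable _ _ _ i1); first exact: measurable_cc.
  apply/measurable_EFinP; apply: measurable_maxr; first exact: itg_meas.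
  exact: measurable_cst.
by move=> y _ /=; rewrite lee_fin; case: (leP (g y) 0) => // _; rewrite normr0.
Qed.

Lemma itg_id c d : itg c d id.
Proof.
apply: (@itg_bounded _ _ _ (`|c| + `|d|)).
  by apply: borel_fun_leb; [exact: measurable_itv|exact: measurable_id].
move=> y /andP[cy yd]; have := ler_norm d; have := ler_norm (- c).
have := normr_ge0 c; have := normr_ge0 d; rewrite normrN ler_norml => *.
by apply/andP; split; lra.
Qed.

Lemma itgZ c d k g : itg c d g -> itg c d (fun y => k * g y).
Proof. by move=> i; exact: (integrableZl (measurable_cc c d) k i). Qed.

Lemma itg_lin c d k e : itg c d (fun y => k * (y - e)).
Proof. by apply/itgZ/itgB; [exact: itg_id|exact: itg_cst]. Qed.

Lemma Int_cst c d k : c <= d -> Int c d (fun=> k) = k * (d - c).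
Proof.
move=> cd; rewrite Rintegral_cst; last exact: measurable_cc.
by rewrite [leb R _]leb_cc.
Qed.

Lemma Int_ge0 c d g : (forall y, c <= y <= d -> 0 <= g y) -> 0 <= Int c d g.
Proof. by move=> g0; apply: Rintegral_ge0 => y; rewrite /= in_itv/=; exact: g0. Qed.

Lemma Int_le c d g1 g2 : itg c d g1 -> itg c d g2 ->
  (forall y, c <= y <= d -> g1 y <= g2 y) -> Int c d g1 <= Int c d g2.
Proof.
move=> i1 i2 g12; apply: le_Rintegral => //; first exact: measurable_cc.
Qed.

Lemma IntD c d g1 g2 : itg c d g1 -> itg c d g2 ->
  Int c d (fun y => g1 y + g2 y) = Int c d g1 + Int c d g2.
Proof. by move=> i1 i2; apply: RintegralD => //; exact: measurable_cc. Qed.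

Lemma IntB c d g1 g2 : itg c d g1 -> itg c d g2 ->
  Int c d (fun y => g1 y - g2 y) = Int c d g1 - Int c d g2.
Proof. by move=> i1 i2; apply: RintegralB => //; exact: measurable_cc. Qed.

Lemma Int_abs c d g : itg c d g -> `|Int c d g| <= Int c d (fun y => `|g y|).
Proof. by move=> i1; apply: le_normr_Rintegral => //; exact: measurable_cc. Qed.

Lemma Int_split c e d g : c <= e -> e <= d -> itg c d g ->
  Int c d g = Int c e g + Int e d g.
Proof.
move=> ce ed icd.
have me : measurable ([set e] : set (lebesgueR R)).
  by apply: borel_leb; exact: measurable_set1.
have -> : Int e d g = Rintegral (leb R) (`[e, d] `\` [set e])%classic g.
  congr fine; apply: (negligible_integral me).
  - exact: measurable_cc.
  - exact: (itgS ce _ icd).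
  - by have : leb R [set e] = 0%E; [exact: lebesgue_measure_set1|].
have cde : `[c, d]%classic = `[c, e]%classic `|` (`[e, d] `\` [set e])%classic.
  apply/seteqP; split=> x /=; rewrite !in_itv/=.
    move=> /andP[cx xd]; case: (leP x e) => xe; [left|right]; rewrite ?cx//.
    by split; [lra|move=> xe'; lra].
  by move=> [/andP[? ?]|[/andP[? ?] _]]; apply/andP; split; lra.
rewrite cde Rintegral_setU//.
- exact: measurable_cc.
- by apply: measurableD => //; exact: measurable_cc.
- by rewrite -cde.
- apply/disj_setPS => x /=; rewrite !in_itv/= => -[/andP[_ xe] [/andP[ex _] ne]].
  by apply: ne; apply/eqP; rewrite eq_le xe.
Qed.

Lemma Int_mono c d c' d' g : c <= c' -> c' <= d' -> d' <= d -> itg c d g ->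
  (forall y, c <= y <= d -> 0 <= g y) -> Int c' d' g <= Int c d g.
Proof.
move=> cc cd dd ig g0; have c'd : c' <= d by lra.
rewrite (Int_split cc c'd ig).
have [l1 l2] : c' <= d' /\ d' <= d by [].
rewrite (Int_split l1 l2); last exact: itgS ig.
have : 0 <= Int c c' g by apply: Int_ge0 => y /andP[? ?]; apply: g0; apply/andP; split; lra.
have : 0 <= Int d' d g by apply: Int_ge0 => y /andP[? ?]; apply: g0; apply/andP; split; lra.
lra.
Qed.

Lemma Int_chebyshev c d c' d' g v : c <= c' -> c' <= d' -> d' <= d -> itg c d g ->
  (forall y, c <= y <= d -> 0 <= g y) -> Int c d g < v * (d' - c') ->
  exists2 y, c' <= y <= d' & g y <= v.
Proof.
move=> cc cd dd ig g0 gv; apply: contrapT => H.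
have gvlt y : c' <= y <= d' -> v <= g y.
  by move=> ycd; rewrite leNgt; apply/negP => /ltW gy; apply: H; exists y.
have := Int_le (itg_cst c' d' v) (itgS cc dd ig) gvlt.
rewrite Int_cst// leNgt => /negP; apply; apply: le_lt_trans gv.
exact: Int_mono.
Qed.
End Toolkit.

(** * A Darboux argument for exact derivatives *)

Lemma exists_outside_countable (R : realType) (u v : R) (C : set R) :
  u < v -> countable C -> exists2 p, u < p < v & ~ C p.
Proof.
move=> uv cC; apply: contrapT => H.
have sub : `]u, v[%classic `<=` C.
  move=> p; rewrite /= in_itv/= => puv; apply: contrapT => nC; apply: H.
  by exists p.
have : (lebesgue_measure `]u, v[%classic <= lebesgue_measure C)%E.
  by apply: le_outer_measure.
rewrite (countable_lebesgue_measure0 cC) lebesgue_measure_itv/= lte_fin uv.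
by rewrite -EFinB lee_fin; lra.
Qed.

(** If g a < g b, choose a level p between them that g misses on C.  The
minimum of Phi y - p * y over [a, b] is interior because the slopes g - p at the
ends point inwards, so g = p there; but outside C the function Phi y - p * y has
smaller values immediately to the right. *)
Lemma darboux_nonincreasing (R : realType) (Phi g : R -> R) (a b : R) (C : set R) :
  a <= b -> countable C ->
  (forall x e : R, a <= x <= b -> 0 < e -> exists2 d : R, 0 < d &
    forall y, a <= y <= b -> `|y - x| < d ->
      `|Phi y - Phi x - g x * (y - x)| <= e * `|y - x|) ->
  (forall x d : R, a < x < b -> ~ C x -> 0 < d -> exists y,
    [/\ x < y, y < x + d, y <= b & Phi y - Phi x - g x * (y - x) < 0]) ->
  g b <= g a.
Proof.
move=> ab cC dPhi decr; rewrite leNgt; apply/negP => gab.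
have [p /andP[ap pb] nCp] := exists_outside_countable gab
  (sub_countable (card_image_le g C) cC).
have ltab : a < b.
  by rewrite lt_neqAle ab andbT; apply/eqP => eab; move: gab; rewrite eab ltxx.
pose Psi y := Phi y - p * y.
have cPsi : {within `[a, b], continuous Psi}.
  apply/subspace_continuousP => x; rewrite /= in_itv/= => xab.
  apply/cvgrPdist_lt => e e0.
  have [d d0 Hd] := dPhi x 1 xab ltr01.
  pose M := 2 + `|g x - p|.
  have M0 : 0 < M by rewrite /M; have := normr_ge0 (g x - p); lra.
  rewrite !near_withinE; near=> y => /=; rewrite in_itv/= => yab.
  have yd : `|y - x| < d.
    by near: y; apply: (cvgr_distC_lt id); [exact: cvg_id|].
  have ye : `|y - x| < e / M.
    by near: y; apply: (cvgr_distC_lt id); [exact: cvg_id|exact: divr_gt0].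
  have := Hd _ yab yd; rewrite mul1r => H1.
  have -> : Psi x - Psi y =
    - (Phi y - Phi x - g x * (y - x)) - (g x - p) * (y - x) by rewrite /Psi; ring.
  apply: le_lt_trans (ler_normB _ _) _; rewrite normrN normrM.
  move: ye; rewrite ltr_pdivlMr// /M => ye.
  have := normr_ge0 (y - x); lra.
have [x0 x0ab minx0] := EVT_min ab cPsi.
move: x0ab; rewrite in_itv/= => x0ab.
have min y : a <= y <= b -> Phi x0 - p * x0 <= Phi y - p * y.
  by move=> yab; apply: minx0; rewrite in_itv.
(* a minimum with g < p is impossible before b, one with g > p after a *)
have ge_p : x0 < b -> p <= g x0.
  move=> x0b; rewrite leNgt; apply/negP => lt_p.
  have [|d d0 Hd] := dPhi x0 ((p - g x0) / 2) x0ab; first by lra.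
  pose y := Num.min b (x0 + d / 2).
  have [yx yb yd] : [/\ x0 < y, y <= b & y - x0 < d].
    by rewrite /y; case: (leP b (x0 + d / 2)) => ?; split; lra.
  have yab : a <= y <= b by apply/andP; split; move: x0ab => /andP[]; lra.
  have := Hd _ yab; rewrite gtr0_norm ?subr_gt0// => /(_ yd).
  rewrite ler_norml => /andP[_ H]; have := min _ yab.
  have : 0 < (p - g x0) * (y - x0) by apply: mulr_gt0; lra.
  lra.
have le_p : a < x0 -> g x0 <= p.
  move=> x0b; rewrite leNgt; apply/negP => lt_p.
  have [|d d0 Hd] := dPhi x0 ((g x0 - p) / 2) x0ab; first by lra.
  pose y := Num.max a (x0 - d / 2).
  have [yx yb yd] : [/\ y < x0, a <= y & x0 - y < d].
    by rewrite /y; case: (leP a (x0 - d / 2)) => ?; split; lra.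
  have yab : a <= y <= b by apply/andP; split; move: x0ab => /andP[]; lra.
  have := Hd _ yab; rewrite distrC gtr0_norm ?subr_gt0// => /(_ yd).
  rewrite ler_norml => /andP[_ H]; have := min _ yab.
  have : 0 < (g x0 - p) * (x0 - y) by apply: mulr_gt0; lra.
  lra.
case/andP: x0ab; rewrite le_eqVlt => /predU1P[eax _|ax0].
  by move: ge_p; rewrite -eax => /(_ ltab); lra.
rewrite le_eqVlt => /predU1P[ebx|x0b].
  by move: le_p; rewrite ebx => /(_ ltab); lra.
have gp : g x0 = p by apply/eqP; rewrite eq_le le_p// ge_p.
have [||y [xy _ yb]] := decr x0 1 _ _ ltr01; first by rewrite ax0.
  by move=> Cx0; apply: nCp; exists x0.
have yab : a <= y <= b by apply/andP; split; lra.
by have := min _ yab; rewrite gp; lra.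
Unshelve. all: by end_near. Qed.

(** * A small increasing function that is infinitely steep on a null set *)

Lemma negligible_open_cover (R : realType) (N : set R) (e : R) :
  (leb R).-negligible (N : set (lebesgueR R)) -> 0 < e ->
  exists U : set R, [/\ open U, N `<=` U & (leb R U <= e%:E)%E].
Proof.
move=> [A [mA A0 NA]] e0.
have [U [oU AU Ue]] := @outer_measure_open_le R A _ e0.
exists U; split => //; first exact: subset_trans AU.
by apply: le_trans Ue _; rewrite [X in (X + _)%E](_ : _ = leb R A)// A0 add0e.
Qed.

Definition cdf_of (R : realType) (U : set R) (x : R) : R :=
  fine (leb R (U `&` `]-oo, x]%classic)).

Section CdfOf.
Context {R : realType} (U : set R) (e : R).
Hypotheses (oU : open U) (Ue : (leb R U <= e%:E)%E).

Let mUI (I : interval R) :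
  measurable (U `&` [set` I] : set (lebesgueR R)).
Proof.
apply: borel_leb; apply: measurableI; first exact: open_measurable.
exact: measurable_itv.
Qed.

Let fin A : A `<=` U -> leb R A \is a fin_num.
Proof.
move=> AU; rewrite ge0_fin_numE; last exact: outer_measure_ge0.
apply: le_lt_trans (ltry e); apply: le_trans Ue.
exact: le_outer_measure.
Qed.

Lemma cdf_of_ge0 x : 0 <= cdf_of U x.
Proof. by rewrite /cdf_of fine_ge0//; exact: outer_measure_ge0. Qed.

Lemma cdf_of_le x : cdf_of U x <= e.
Proof.
rewrite -lee_fin fineK; last by apply: fin; exact: subIsetl.
by apply: le_trans Ue; apply: le_outer_measure; exact: subIsetl.
Qed.

Lemma cdf_ofB x y : x <= y ->
  cdf_of U y - cdf_of U x = fine (leb R (U `&` `]x, y]%classic)).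
Proof.
move=> xy; rewrite /cdf_of.
have -> : U `&` `]-oo, y]%classic = (U `&` `]-oo, x]%classic) `|` (U `&` `]x, y]%classic).
  rewrite -setIUr; congr (_ `&` _); apply/seteqP; split => z /=; rewrite !in_itv/=.
    by case: (leP z x) => zx zy; [left|right].
  by case=> [|/andP[_ //]]; lra.
rewrite measureU//; last 1 first.
  apply/seteqP; split => z //= -[[_]]; rewrite !in_itv/= => zx [_ /andP[xz _]].
  lra.
by rewrite fineD ?fin//; [rewrite addrC addKr|exact: subIsetl..].
Qed.

Lemma cdf_of_homo x y : x <= y -> cdf_of U x <= cdf_of U y.
Proof.
by move=> xy; rewrite -subr_ge0 cdf_ofB// fine_ge0//; exact: outer_measure_ge0.
Qed.

Let leb_oc x y : x <= y -> leb R `]x, y]%classic = (y - x)%:E.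
Proof.
move=> xy; have -> : leb R `]x, y]%classic = lebesgue_measure `]x, y]%classic by [].
rewrite lebesgue_measure_itv/= lte_fin; case: ltP => // yx.
by have -> : x = y; [apply/eqP; rewrite eq_le xy|rewrite subrr].
Qed.

Lemma cdf_of_lip x y : x <= y -> cdf_of U y - cdf_of U x <= y - x.
Proof.
move=> xy; rewrite cdf_ofB// -lee_fin fineK; last by apply: fin; exact: subIsetl.
by rewrite -leb_oc//; apply: le_outer_measure; exact: subIsetr.
Qed.

Lemma cdf_of_slope x : U x -> exists2 d : R, 0 < d &
  forall y, x < y < x + d -> cdf_of U y - cdf_of U x = y - x.
Proof.
move=> Ux; have /nbhs_ballP[d /= d0 dU] : nbhs x U by exact: open_nbhs_nbhs.
exists d => // y /andP[xy yd]; rewrite cdf_ofB ?ltW//.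
rewrite (_ : U `&` _ = `]x, y]%classic) ?leb_oc ?ltW//.
apply/seteqP; split => [z []//|z /=]; rewrite in_itv/= => /andP[xz zy]; split=> //.
  by apply: dU; rewrite /ball/= ltr_distlC; apply/andP; split; lra.
by rewrite xz.
Qed.
End CdfOf.

(** The function is the sum over k of |U k \cap ]-oo, x]| for open sets U k
containing N with |U k| <= e / 2^(k+1).  Near a point of N the first K summands
all have slope 1, so the slope of the sum exceeds every K. *)
Lemma exists_steep_function (R : realType) (N : set R) (e : R) :
  (leb R).-negligible (N : set (lebesgueR R)) -> 0 < e ->
  exists w : R -> R,
    [/\ forall x y, x <= y -> w x <= w y,
        forall x y, w y - w x <= e,
        forall n : R, 0 < n -> exists2 d : R, 0 < d &
          forall x y, x <= y -> y - x < d -> w y - w x <= n &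
        forall x (K : R), N x -> exists2 d : R, 0 < d &
          forall y, x < y < x + d -> K * (y - x) <= w y - w x].
Proof.
move=> nN e0.
have ek0 k : 0 < e / 2 * 2^-1 ^+ k by rewrite mulr_gt0 ?exprn_gt0; lra.
have /choice[U HU] k := negligible_open_cover nN (ek0 k).
have oU k : open (U k) by case: (HU k).
have UN k : N `<=` U k by case: (HU k).
have Ue k : (leb R (U k) <= (e / 2 * 2^-1 ^+ k)%:E)%E by case: (HU k).
pose w k x := cdf_of (U k) x.
pose S x : R^nat := series (fun k => w k x).
have geo n : series (fun k => e / 2 * 2^-1 ^+ k) n = e * (1 - 2^-1 ^+ n) :> R.
  elim: n => [|n IH]; first by rewrite /series/= big_geq// expr0; lra.
  rewrite seriesSr IH exprS; lra.
have incS x n m : (n <= m)%N -> S x n <= S x m.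
  move=> nm; apply: (nondecreasing_series (P := predT)) => // k _ _.
  exact: cdf_of_ge0.
have leS x n : S x n <= e.
  apply: (@le_trans _ _ (series (fun k => e / 2 * 2^-1 ^+ k) n)).
    by apply: ler_sum => k _; exact: cdf_of_le.
  rewrite geo; have : (0 : R) < 2^-1 ^+ n by rewrite exprn_gt0.
  move=> h; rewrite ler_piMr ?ltW//; lra.
have cS x : cvgn (S x).
  apply: nondecreasing_is_cvgn; first by move=> n m; exact: incS.
  by exists e => _ [n _ <-]; exact: leS.
have dS x y n : x <= y -> 0 <= S y n - S x n.
  move=> xy; rewrite /S /series/= -sumrB sumr_ge0// => k _.
  by rewrite subr_ge0; exact: (cdf_of_homo (oU k) (Ue k)).
have dSinc x y n m : x <= y -> (n <= m)%N -> S y n - S x n <= S y m - S x m.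
  move=> xy nm; rewrite /S /series/= -!sumrB (big_cat_nat (leq0n n) nm)/=.
  rewrite lerDl sumr_ge0// => k _.
  by rewrite subr_ge0; exact: (cdf_of_homo (oU k) (Ue k)).
have dStail x y n m : x <= y -> (n <= m)%N ->
    S y m - S x m <= S y n - S x n + e * 2^-1 ^+ n.
  move=> xy nm; rewrite /S /series/= -!sumrB (big_cat_nat (leq0n n) nm)/= lerD2l.
  apply: (@le_trans _ _ (\sum_(n <= k < m) e / 2 * 2^-1 ^+ k)).
    apply: ler_sum => k _; have := cdf_of_le (Ue k) y.
    by have := @cdf_of_ge0 _ (U k) x; rewrite /w; lra.
  have := geo m; rewrite /series/= (big_cat_nat (leq0n n) nm)/= => hm.
  have := geo n; rewrite /series/= => hn; rewrite hn in hm.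
  have : e * 2^-1 ^+ m >= 0 by rewrite mulr_ge0 ?exprn_ge0; lra.
  lra.
pose W x := limn (S x).
have cD x y : (S y n - S x n) @[n --> \oo] --> W y - W x by apply: cvgB; exact: cS.
have geD x y n : x <= y -> S y n - S x n <= W y - W x.
  move=> xy; apply: (cvgr_to_ge (cD x y)).
  by exists n => // m /= nm; exact: dSinc.
have leD x y n : x <= y -> W y - W x <= S y n - S x n + e * 2^-1 ^+ n.
  move=> xy; apply: (cvgr_to_le (cD x y)).
  by exists n => // m /= nm; exact: dStail.
exists W; split.
- by move=> x y xy; rewrite -subr_ge0; apply: le_trans (geD x y 0%N xy); exact: dS.
- move=> x y; have [xy|yx] := leP x y.
    have := leD x y 0%N xy; rewrite /S /series/= !big_geq// expr0; lra.
  have := le_trans (dS _ _ 0%N (ltW yx)) (geD _ _ 0%N (ltW yx)); lra.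
- move=> n n0.
  have [M HM] : exists M, e * 2^-1 ^+ M < n / 2.
    have : (2^-1 ^+ k) @[k --> \oo] --> (0 : R).
      by apply: cvg_expr; rewrite gtr0_norm; lra.
    move/cvgr0Pnorm_lt => /(_ (n / 2 / e)); case; first by rewrite !divr_gt0.
    move=> M _ /(_ M (leqnn M)); rewrite /= ger0_norm ?exprn_ge0//.
    by rewrite ltr_pdivlMr// mulrC; exists M.
  exists (n / 2 / M.+1%:R); first by rewrite !divr_gt0.
  move=> x y xy yxd; have := leD _ _ M xy.
  have : S y M - S x M <= (y - x) * M.+1%:R.
    apply: (@le_trans _ _ ((y - x) * M%:R)); last first.
      by rewrite ler_wpM2l ?ler_nat// subr_ge0.
    rewrite /S /series/= -sumrB mulr_natr -[M in X in _ <= X]subn0 -sumr_const_nat.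
    by apply: ler_sum => k _; exact: (cdf_of_lip (oU k) (Ue k)).
  move: yxd; rewrite ltr_pdivlMr//; lra.
- move=> x K Nx.
  pose M := (Num.truncn `|K|).+1.
  have KM : K <= M%:R.
    by apply: le_trans (ler_norm _) (ltW _); rewrite truncnS_gt.
  have [d d0 Hd] : exists2 d : R, 0 < d & forall y, x < y < x + d ->
      forall k, (k < M)%N -> w k y - w k x = y - x.
    elim: M {KM} => [|M [d d0 Hd]]; first by exists 1.
    have [d' d'0 Hd'] := cdf_of_slope (oU M) (Ue M) (UN M _ Nx).
    exists (Num.min d d'); first by rewrite lt_min d0.
    move=> y /andP[xy]; rewrite -ltrBlDl lt_min => /andP[yd yd'] k.
    rewrite ltnS leq_eqVlt => /predU1P[->|kM].
      by apply: Hd'; apply/andP; split; lra.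
    by apply: Hd => //; apply/andP; split; lra.
  exists d => // y xyd; have /andP[xy _] := xyd.
  apply: le_trans (geD _ _ M (ltW xy)).
  rewrite /S /series/= -sumrB big_mkord.
  rewrite (eq_bigr (fun=> y - x)); last by move=> k _; exact: Hd.
  by rewrite sumr_const card_ord -mulr_natl ler_wpM2r// subr_ge0 ltW.
Qed.

(** * Monotonicity from right derivates in the mean of order 1 *)

Lemma pos_ge (R : realType) (u : R) : u <= Num.max u 0 /\ 0 <= Num.max u 0.
Proof. by rewrite !le_max !lexx orbT. Qed.

(** The windows [u, v] need not be centred at x, so that the notion passes to
subintervals of [a, b]. *)
Definition L1_continuous (R : realType) (a b : R) (g : R -> R) : Prop :=
  forall x, a <= x <= b -> forall e : R, 0 < e -> exists2 d : R, 0 < d &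
    forall u v, a <= u -> u <= x -> x <= v -> v <= b -> v - u < d ->
      Int u v (fun y => `|g y - g x|) <= e * (v - u).

(** This puts alpha among the numbers whose infimum is the upper right derivate of
order 1 of g at x; the square stems from an integral that is not divided by the
length of the window. *)
Definition right_L1_bound (R : realType) (b : R) (g : R -> R) (x alpha : R) : Prop :=
  forall e : R, 0 < e -> exists2 d : R, 0 < d &
    forall y, x < y < x + d -> y <= b ->
      Int x y (fun z => Num.max (g z - g x - alpha * (z - x)) 0) <= e * (y - x) ^+ 2.

Section L1calc.
Context {R : realType}.
Implicit Types (a b x u v e alpha beta : R) (g h : R -> R).

Lemma itg_incr a b g x : itg a b g -> itg a b (fun y => g y - g x).
Proof. by move=> ig; apply: itgB ig (itg_cst _ _ _). Qed.

Lemma Int_incr u v g k : u <= v -> itg u v g ->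
  Int u v (fun y => g y - k) = Int u v g - k * (v - u).
Proof. by move=> uv ig; rewrite IntB ?Int_cst//; exact: itg_cst. Qed.

Lemma itg_rb a b g x alpha : itg a b g ->
  itg a b (fun z => Num.max (g z - g x - alpha * (z - x)) 0).
Proof.
by move=> ig; apply: itg_pos; apply: itgB (itg_lin _ _ _ _); exact: itg_incr.
Qed.

Lemma right_L1_bound_add a b g h x alpha beta : a <= x ->
  itg a b g -> itg a b h ->
  right_L1_bound b g x alpha -> right_L1_bound b h x beta ->
  right_L1_bound b (fun y => g y + h y) x (alpha + beta).
Proof.
move=> ax ig ih Hg Hh e e0; have e20 : 0 < e / 2 by lra.
have [d d0 Hd] := Hg _ e20; have [d' d'0 Hd'] := Hh _ e20.
exists (Num.min d d'); first by rewrite lt_min d0.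
move=> y /andP[xy]; rewrite -ltrBlDl lt_min => /andP[yd yd'] yb.
have {}ig := itgS ax yb ig; have {}ih := itgS ax yb ih.
have := Hd y _ yb; have := Hd' y _ yb; rewrite xy/= -!ltrBlDl => /(_ yd') H1 /(_ yd) H2.
apply: le_trans (_ : Int x y (fun z => Num.max (g z - g x - alpha * (z - x)) 0) +
  Int x y (fun z => Num.max (h z - h x - beta * (z - x)) 0) <= _); last by lra.
rewrite -IntD; [|exact: itg_rb..].
apply: Int_le; [exact/itg_rb/itgD|apply: itgD; exact: itg_rb|].
move=> z _; rewrite ge_max; apply/andP; split.
  have [? _] := pos_ge (g z - g x - alpha * (z - x)).
  have [? _] := pos_ge (h z - h x - beta * (z - x)).
  by rewrite mulrDl; lra.
by apply: addr_ge0; rewrite le_max lexx orbT.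
Qed.

Lemma right_L1_bound_le a b g x alpha beta : a <= x -> itg a b g ->
  alpha <= beta -> right_L1_bound b g x alpha -> right_L1_bound b g x beta.
Proof.
move=> ax ig ab Hg e e0; have [d d0 Hd] := Hg _ e0; exists d => // y xy yb.
apply: le_trans (Hd y xy yb); have {}ig := itgS ax yb ig.
apply: Int_le; [exact: itg_rb..|move=> z /andP[xz _]].
apply: le_max2 => //; rewrite lerD2l lerN2 ler_wpM2r ?subr_ge0//.
Qed.

Lemma right_L1_bound_pointwise b g x alpha :
  (exists2 d : R, 0 < d & forall y, x < y < x + d -> g y - g x <= alpha * (y - x)) ->
  right_L1_bound b g x alpha.
Proof.
move=> [d d0 Hd] e e0; exists d => // y /andP[xy yd] _.
rewrite (_ : Int x y _ = Int x y (fun=> 0)).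
  by rewrite Int_cst ?(ltW xy)// mul0r mulr_ge0 ?(ltW e0)// sqr_ge0.
apply: eq_Rintegral => z; rewrite inE /= in_itv/= => /andP[xz zy].
apply/max_idPr; rewrite subr_le0; move: xz; rewrite le_eqVlt => /predU1P[<-|xz].
  by rewrite !subrr mulr0.
by apply: Hd; apply/andP; split; lra.
Qed.

Lemma L1_continuousD a b g h : itg a b g -> itg a b h ->
  L1_continuous a b g -> L1_continuous a b h -> L1_continuous a b (fun y => g y + h y).
Proof.
move=> ig ih cg ch x xab e e0; have e20 : 0 < e / 2 by lra.
have [d d0 Hd] := cg x xab _ e20; have [d' d'0 Hd'] := ch x xab _ e20.
exists (Num.min d d'); first by rewrite lt_min d0.
move=> u v au ux xv vb; rewrite lt_min => /andP[vd vd'].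
have := Hd u v au ux xv vb vd; have := Hd' u v au ux xv vb vd' => H1 H2.
have {}ig := itgS au vb ig; have {}ih := itgS au vb ih.
apply: le_trans (_ : Int u v (fun z => `|g z - g x|) +
  Int u v (fun z => `|h z - h x|) <= _); last by lra.
rewrite -IntD; [|exact/itg_abs/itg_incr..].
apply: Int_le; [exact/itg_abs/itg_incr/itgD|apply: itgD; exact/itg_abs/itg_incr|].
move=> z _; rewrite (_ : g z + h z - (g x + h x) = (g z - g x) + (h z - h x)); last by ring.
exact: ler_normD.
Qed.

Lemma L1_continuousN a b g :
  L1_continuous a b g -> L1_continuous a b (fun y => - g y).
Proof.
move=> cg x xab e e0; have [d d0 Hd] := cg x xab _ e0; exists d => // u v au ux xv vb vd.
rewrite (_ : Int u v _ = Int u v (fun y => `|g y - g x|)); first exact: Hd.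
by apply: eq_Rintegral => z _; rewrite opprK addrC distrC.
Qed.

Lemma L1_continuous_of_continuous a b g : itg a b g ->
  (forall x, a <= x <= b -> forall e, 0 < e -> exists2 d : R, 0 < d &
     forall y, a <= y <= b -> `|y - x| < d -> `|g y - g x| <= e) ->
  L1_continuous a b g.
Proof.
move=> ig cg x xab e e0; have [d d0 Hd] := cg x xab _ e0; exists d => // u v au ux xv vb vd.
rewrite -Int_cst; last by lra.
have {}ig := itgS au vb ig.
apply: Int_le; [exact/itg_abs/itg_incr|exact: itg_cst|].
move=> y /andP[uy yv]; apply: Hd; first by apply/andP; split; lra.
by rewrite ltr_norml; apply/andP; split; lra.
Qed.

Lemma L1_continuousS a b u v g : a <= u -> v <= b ->
  L1_continuous a b g -> L1_continuous u v g.
Proof.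
move=> au vb cg x /andP[ux xv] e e0.
have xab : a <= x <= b by apply/andP; split; lra.
have [d d0 Hd] := cg x xab _ e0; exists d => // u' v' *; apply: Hd => //; lra.
Qed.

Lemma right_L1_boundS b v g x alpha : v <= b ->
  right_L1_bound b g x alpha -> right_L1_bound v g x alpha.
Proof.
move=> vb Hg e e0; have [d d0 Hd] := Hg _ e0; exists d => // y *; apply: Hd => //; lra.
Qed.

End L1calc.

(** Continuity in the mean makes g the derivative, at every point, of its
integral.  Subtracting from g a function of oscillation at most e that is
infinitely steep on N makes the right derivate nonpositive also on N, and
subtracting e x^2 from the integral makes all inequalities strict; the Darboux
argument applies to the result, and e is arbitrary. *)
Theorem L1_nonincreasing (R : realType) (a b : R) (g : R -> R) (N C : set R) :
  a <= b -> itg a b g -> L1_continuous a b g ->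
  (leb R).-negligible (N : set (lebesgueR R)) -> countable C ->
  (forall x, a < x < b -> ~ N x -> forall e : R, 0 < e -> right_L1_bound b g x e) ->
  (forall x, a < x < b -> ~ C x -> exists alpha, right_L1_bound b g x alpha) ->
  g b <= g a.
Proof.
move=> ab ig cg nN cC gN gC.
suff H e : 0 < e -> g b <= g a + e * (1 + 2 * (b - a)).
  apply/ler_addgt0Pr => e e0.
  have p0 : 0 < 1 + 2 * (b - a) by lra.
  by have := H (e / (1 + 2 * (b - a))) (divr_gt0 e0 p0); rewrite divfK// gt_eqF.
move=> e0; have [w [wmono we wcont wsteep]] := exists_steep_function nN e0.
have iw : itg a b w.
  apply: (@itg_bounded _ _ _ _ (`|w a| + `|w b|)).
    apply: borel_fun_leb; first exact: measurable_itv.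
    exact: nondecreasing_measurable.
  move=> y /andP[/wmono ay /wmono yb].
  have := ler_norm (w b); have := ler_norm (- w a); rewrite normrN.
  have := normr_ge0 (w a); have := normr_ge0 (w b); rewrite ler_norml => *.
  by apply/andP; split; lra.
have cw : L1_continuous a b w.
  apply: L1_continuous_of_continuous => // x _ n n0.
  have [d d0 Hd] := wcont n n0; exists d => // y _.
  have [xy|yx] := leP x y.
    by rewrite ger0_norm ?subr_ge0// => yd; rewrite ger0_norm ?subr_ge0 ?wmono// Hd.
  rewrite distrC ger0_norm ?subr_ge0 ?(ltW yx)// => yd.
  by rewrite distrC ger0_norm ?subr_ge0 ?wmono ?Hd ?(ltW yx).
pose G y := g y + - w y.
have iG : itg a b G by apply: itgD ig (itgN iw).
have cG : L1_continuous a b G.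
  by apply: L1_continuousD => //; [exact: itgN|exact: L1_continuousN].
pose Phi y := Int a y G - e * y ^+ 2.
have PhiB x y : a <= x -> x <= y -> y <= b ->
    Phi y - Phi x - (G x - 2 * e * x) * (y - x) =
    Int x y (fun z => G z - G x) - e * (y - x) ^+ 2.
  move=> ax xy yb; rewrite /Phi (Int_split ax xy (itgS (lexx _) yb iG)).
  by rewrite (Int_incr (G x) xy (itgS ax yb iG)); ring.
have GxE x : a < x < b -> ~ C x -> right_L1_bound b G x (e / 4).
  move=> xab nCx; have ax : a <= x by case/andP: xab => /ltW.
  have [Nx|nNx] := pselect (N x).
    have [al Hal] := gC x xab nCx.
    apply: (right_L1_bound_le (alpha := al + - al) ax iG); first by lra.
    apply: (right_L1_bound_add ax ig (itgN iw) Hal).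
    apply: right_L1_bound_pointwise.
    have [d d0 Hd] := wsteep x al Nx; exists d => // y /Hd; lra.
  apply: (right_L1_bound_le (alpha := e / 4 + 0) ax iG); first by lra.
  apply: (right_L1_bound_add ax ig (itgN iw)); first by apply: gN => //; lra.
  apply: right_L1_bound_pointwise; exists 1 => // y /andP[/ltW/wmono xy _]; lra.
suff : G b - 2 * e * b <= G a - 2 * e * a.
  by rewrite /G; have := we a b; lra.
apply: (darboux_nonincreasing (Phi := Phi) (g := fun x => G x - 2 * e * x) ab cC).
  move=> x e1 xab e10; have e120 : 0 < e1 / 2 by lra.
  have [d d0 Hd] := cG x xab _ e120.
  exists (Num.min d (e1 / 2 / e)); first by rewrite lt_min d0 divr_gt0.
  move=> y yab; rewrite lt_min => /andP[yd]; rewrite ltr_pdivlMr// => ye.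
  have [/andP[ax xb] /andP[ay yb]] := (xab, yab).
  have sq : e * (y - x) ^+ 2 <= e1 / 2 * `|y - x|.
    by rewrite -real_normK ?num_real// expr2 mulrA ler_wpM2r// mulrC ltW.
  have sq0 : 0 <= e * (y - x) ^+ 2 by rewrite mulr_ge0 ?sqr_ge0// ltW.
  have [xy|/ltW yx] := leP x y.
    rewrite PhiB//; move: yd sq; rewrite ger0_norm ?subr_ge0// => yd sq.
    have := Hd x y ax (lexx _) xy yb yd.
    have := Int_abs (itg_incr x (itgS ax yb iG)).
    have := sq0; move: (Int x y _) (Int x y _) => I1 I2.
    rewrite !ler_norml => ? /andP[? ?] ?; apply/andP; split; lra.
  move: yd sq; rewrite distrC ger0_norm ?subr_ge0// => yd sq.
  have := Hd y x ay yx (lexx _) xb yd.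
  have iyx := itgS ay xb iG.
  have := Int_abs (itg_incr x iyx).
  have -> : Phi y - Phi x - (G x - 2 * e * x) * (y - x) =
    - (Int y x (fun z => G z - G x) + e * (y - x) ^+ 2).
    rewrite /Phi (Int_split ay yx (itgS (lexx _) xb iG)).
    by rewrite (Int_incr (G x) yx iyx); ring.
  move: sq0; rewrite normrN; move: (Int y x _) (Int y x _) => I1 I2.
  rewrite !ler_norml => ? /andP[? ?] ?; apply/andP; split; lra.
move=> x d xab nCx d0.
have e40 : 0 < e / 4 by lra.
have [d' d'0 Hd'] := GxE x xab nCx _ e40.
have /andP[ax xb] := xab.
pose m := Num.min (Num.min d d') (b - x).
have m0 : 0 < m by rewrite !lt_min d0 d'0 subr_gt0.
have [md md' mb] : [/\ m <= d, m <= d' & m <= b - x].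
  by rewrite /m !ge_min !lexx ?orbT.
exists (x + m / 2); split; [lra|lra|lra|].
set y := x + m / 2; have xy : x <= y by rewrite /y; lra.
have yb : y <= b by rewrite /y; lra.
rewrite PhiB//; last exact: ltW.
have {}iG := itgS (ltW ax) yb iG.
have : Int x y (fun z => G z - G x) <=
    Int x y (fun z => Num.max (G z - G x - e / 4 * (z - x)) 0 + e / 4 * (y - x)).
  apply: Int_le; [exact: itg_incr|exact: (itgD (itg_rb x (e / 4) iG) (itg_cst _ _ _))|].
  move=> z /andP[xz zy]; have [+ _] := pos_ge (G z - G x - e / 4 * (z - x)).
  have : e / 4 * (z - x) <= e / 4 * (y - x) by rewrite ler_wpM2l ?(ltW e40)// lerD2r.
  lra.
rewrite (IntD (itg_rb x (e / 4) iG) (itg_cst _ _ _)) Int_cst//.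
have := Hd' y _ yb; rewrite /y ltrDl divr_gt0//= ltrD2l => H.
have /H {H} : m / 2 < d' by lra.
have : 0 < e * (x + m / 2 - x) ^+ 2 by rewrite mulr_gt0// exprn_gt0//; lra.
lra.
Qed.

(** * From minor functions of order s to means of order 1 *)

Lemma near_right0P (R : realType) (P : R -> Prop) :
  (\forall h \near 0^'+, P h) <-> exists2 d : R, 0 < d & forall h, 0 < h < d -> P h.
Proof.
rewrite near_withinE; split.
  move=> /nbhs_ballP[d /= d0 Hd]; exists d => // h /andP[h0 hd].
  by apply: Hd => //; rewrite /ball/= sub0r normrN gtr0_norm.
move=> [d d0 Hd]; apply/nbhs_ballP; exists d => //= h; rewrite /ball/= sub0r normrN.
by move=> hd h0; apply: Hd; rewrite h0 -(gtr0_norm h0).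
Qed.

Lemma littleo_id_right0P (R : realType) (f : R -> R) :
  f =o_ (0^'+) id <-> forall e : R, 0 < e -> exists2 d : R, 0 < d &
    forall h, 0 < h < d -> `|f h| <= e * h.
Proof.
have E : f =o_ (0^'+) id <-> forall e : R, 0 < e -> \forall h \near 0^'+, `|f h| <= e * `|h|.
  exact: eqoP.
rewrite E; split=> H e e0.
  have /near_right0P[d d0 Hd] := H e e0; exists d => // h hd.
  by rewrite -[h in _ * h]gtr0_norm ?Hd//; case/andP: hd.
have [d d0 Hd] := H e e0; apply/near_right0P; exists d => // h hd.
by have := Hd h hd; case/andP: hd => h0 _; rewrite (gtr0_norm h0).
Qed.

Section Mean.
Context {R : realType}.
Implicit Types (s l c h u v : R) (g : R -> R).

(** This elementary inequality replaces that of Hoelder: if c bounds the mean of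
order s of t, integrating it bounds the mean of order 1 by 2 c. *)
Lemma le_addr_powR s c t : 1 <= s -> 0 < c -> 0 <= t ->
  t <= c + c * c^-1 `^ s * t `^ s.
Proof.
move=> s1 c0 t0; have tc0 : 0 <= t / c by rewrite divr_ge0 ?(ltW c0).
suff H : t / c <= 1 + (t / c) `^ s.
  have := ler_wpM2l (ltW c0) H; rewrite mulrCA divff ?gt_eqF// mulr1 mulrDr mulr1.
  by rewrite powRM ?invr_ge0 ?(ltW c0)// (mulrC (t `^ s)) mulrA.
have [tc|/ltW tc] := leP (t / c) 1; first by have := powR_ge0 (t / c) s; lra.
by have := le1r_powR tc s1; lra.
Qed.

Lemma meanpow_ge0 s l (D : set R) g : 0 <= meanpow s l D g.
Proof. exact: powR_ge0. Qed.

Lemma meanpow_le_L1 s l u v g c : 1 <= s -> 0 < l -> 0 < c -> u <= v ->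
  (forall y, u <= y <= v -> 0 <= g y) -> itg u v g -> itg u v (fun y => g y `^ s) ->
  meanpow s l `[u, v] g <= c -> Int u v g <= c * (v - u + l).
Proof.
move=> s1 l0 c0 uv g0 ig igs mc.
have s0 : s != 0 by rewrite gt_eqF//; lra.
set I := Int u v (fun y => g y `^ s).
have I0 : 0 <= l^-1 * I.
  by rewrite mulr_ge0 ?invr_ge0 ?(ltW l0)//; apply: Int_ge0 => y _; exact: powR_ge0.
have Ic : l^-1 * I <= c `^ s.
  rewrite -[leLHS]powRr1// -(mulVf s0) powRrM; apply: ge0_ler_powR => //; first lra.
  - by rewrite nnegrE powR_ge0.
  - by rewrite nnegrE ltW.
have cs : c * c^-1 `^ s * c `^ s = c.
  by rewrite -mulrA -powRM ?invr_ge0 ?(ltW c0)// mulVf ?gt_eqF// powR1 mulr1.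
have k0 : 0 <= c * c^-1 `^ s by rewrite mulr_ge0 ?powR_ge0// ltW.
apply: (@le_trans _ _ (Int u v (fun y => c + c * c^-1 `^ s * g y `^ s))).
  apply: Int_le => //; first by apply: itgD; [exact: itg_cst|exact: itgZ].
  by move=> y /g0; exact: le_addr_powR.
rewrite (IntD (itg_cst _ _ _) (itgZ _ igs)) Int_cst// (mulrDr c (v - u) l) lerD2l.
rewrite RintegralZl//; last exact: measurable_cc.
move: Ic; rewrite ler_pdivrMl// => Ic.
apply: le_trans (ler_wpM2l k0 Ic) _.
by rewrite mulrCA cs mulrC.
Qed.

Lemma meanpow_shift s l x u v g :
  measurable_fun (`[x + u, x + v]%classic : set (lebesgueR R)) (g : lebesgueR R -> R) ->
  meanpow s l `[u, v] (fun t => g (x + t)) = meanpow s l `[x + u, x + v] g.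
Proof.
move=> mg; suff E : Int u v (fun t => g (x + t) `^ s) =
    Int (x + u) (x + v) (fun y => g y `^ s) by rewrite /meanpow E.
rewrite -(@Rintegral_leb_shift _ x _ (fun y => g y `^ s)); first last.
- by move=> y _; exact: powR_ge0.
- exact: (measurableT_comp (measurable_powR s)).
- exact: measurable_cc.
have -> : ((fun y : R => y + x) @^-1` `[x + u, x + v]%classic) = `[u, v]%classic.
  by apply/seteqP; split => y /=; rewrite !in_itv/= => /andP[? ?]; apply/andP; split; lra.
by apply: eq_Rintegral => y _; rewrite addrC.
Qed.

End Mean.

Section MinorToL1.
Context {R : realType}.
Implicit Types (s a b : R) (f m g : R -> R).

Lemma memL_itg_powR s a b m : memL s a b m -> itg a b (fun y => `|m y| `^ s).
Proof.
move=> [mm mfin]; apply/integrableP; split.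
  apply/measurable_EFinP; apply: (measurableT_comp (measurable_powR s)).
  exact: measurableT_comp.
apply: le_lt_trans mfin; rewrite le_eqVlt; apply/orP; left; apply/eqP.
by apply: eq_integral => y _ /=; rewrite ger0_norm// powR_ge0.
Qed.

Lemma itg_le a b g h : itg a b h ->
  measurable_fun (`[a, b]%classic : set (lebesgueR R)) (g : lebesgueR R -> R) ->
  (forall y, a <= y <= b -> 0 <= g y <= h y) -> itg a b g.
Proof.
move=> ih mg gh; apply: (le_integrable _ _ _ ih); first exact: measurable_cc.
  exact/measurable_EFinP.
move=> y; rewrite /= in_itv/= => /gh /andP[g0 gy]; rewrite lee_fin !ger0_norm//.
exact: le_trans g0 gy.
Qed.

Lemma memL_itg s a b m : 1 <= s -> memL s a b m -> itg a b m.
Proof.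
move=> s1 Lm; have [mm _] := Lm.
have i1 : itg a b (fun y => `|m y|).
  apply: (itg_le (h := fun y => 1 + 1 * 1^-1 `^ s * `|m y| `^ s)).
  - by apply: itgD; [exact: itg_cst|exact/itgZ/memL_itg_powR].
  - exact: measurableT_comp.
  - by move=> y _; rewrite normr_ge0/= le_addr_powR.
apply: (le_integrable _ _ _ i1); first exact: measurable_cc.
  exact/measurable_EFinP.
by move=> y _; rewrite /= normr_id.
Qed.

(** Real-valued integrals are 0 when the integral is infinite, so every bound on
a mean of order s is void until the integrand is known to be integrable. *)
Lemma itg_powR_le s a b m g K : 0 <= s -> 0 <= K -> memL s a b m ->
  measurable_fun (`[a, b]%classic : set (lebesgueR R)) (g : lebesgueR R -> R) ->
  (forall y, a <= y <= b -> 0 <= g y <= `|m y| + K) ->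
  itg a b (fun y => g y `^ s).
Proof.
move=> s0 K0 Lm mg gm.
apply: (itg_le (h := fun y => 2 `^ s * `|m y| `^ s + (2 * K) `^ s)).
- by apply: itgD (itg_cst _ _ _); exact/itgZ/memL_itg_powR.
- exact: (measurableT_comp (measurable_powR s)).
move=> y /gm /andP[g0 gy]; rewrite powR_ge0/=.
have [mK|Km] := leP `|m y| K.
  apply: (@le_trans _ _ ((2 * K) `^ s)).
    by apply: ge0_ler_powR => //; rewrite ?nnegrE; lra.
  by rewrite lerDr mulr_ge0// powR_ge0.
apply: (@le_trans _ _ ((2 * `|m y|) `^ s)).
  by apply: ge0_ler_powR => //; rewrite ?nnegrE; lra.
by rewrite powRM// lerDl powR_ge0.
Qed.

Lemma memL_itg_abs_powR s a b m x : 0 <= s -> memL s a b m ->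
  itg a b (fun y => `|m y - m x| `^ s).
Proof.
move=> s0 Lm; have [mm _] := Lm.
apply: (itg_powR_le (g := fun y => `|m y - m x|) s0 (normr_ge0 (m x)) Lm).
  apply: measurableT_comp; first exact: normr_measurable.
  by apply: measurable_funB; [exact: mm|exact: measurable_cst].
by move=> y _; rewrite normr_ge0/=; exact: ler_normB.
Qed.

(** A window [u, v] around x is contained in the window of radius v - u that the
definition of continuity at x uses, one-sided when x is an endpoint. *)
Lemma Lcontinuous_L1_continuous s a b m : a < b -> 1 <= s -> memL s a b m ->
  (forall x, `[a, b]%classic x -> Lcontinuous_at s a b m x) -> L1_continuous a b m.
Proof.
move=> ab s1 Lm cm x xab e e0.
have s0 : 0 <= s by lra.
have [mm _] := Lm; have im := memL_itg s1 Lm.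
have e30 : 0 < e / 3 by lra.
have := cm x; rewrite /= in_itv/= => /(_ xab) /cvgr0Pnorm_lt /(_ _ e30).
move=> /near_right0P[d d0 Hd].
pose d1 := if x == a then Num.min d (b - a) else if x == b then Num.min d (b - a)
  else Num.min d (Num.min (x - a) (b - x)).
have d10 : 0 < d1.
  rewrite /d1; case: eqP => xa; first by rewrite lt_min d0 subr_gt0.
  case: eqP => xb; first by rewrite lt_min d0 subr_gt0.
  by rewrite !lt_min d0 !subr_gt0 !lt_neqAle; case/andP: xab => -> ->; rewrite eq_sym;
     move/eqP: xa => ->; move/eqP: xb => ->.
have [lo [hi [lohi wE]]] : exists lo hi : R -> R,
    (forall h, 0 < h < d1 -> [/\ a <= x + lo h, x + hi h <= b & hi h - lo h <= 2 * h] /\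
      (forall u v, a <= u -> u <= x -> x <= v -> v <= b -> v - u <= h ->
         x + lo h <= u /\ v <= x + hi h)) /\
    (forall h, window a b x h = `[lo h, hi h]%classic).
  rewrite /d1 /window; case: eqP => [->|xa].
    exists (fun=> 0), id; split=> // h; rewrite lt_min => /andP[h0 /andP[hd hb]].
    by split; [split; lra|move=> *; split; lra].
  case: eqP => [->|xb].
    exists -%R, (fun=> 0); split=> // h; rewrite lt_min => /andP[h0 /andP[hd hb]].
    by split; [split; lra|move=> *; split; lra].
  exists -%R, id; split=> // h; rewrite !lt_min => /andP[h0 /andP[hd /andP[hb ha]]].
  by split; [split; lra|move=> *; split; lra].
have d1d : d1 <= d.
  by rewrite /d1; case: ifP => _; [|case: ifP => _]; rewrite ge_min lexx.
exists d1 => // u v au ux xv vb vd.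
have [uv|uv] := leP v u.
  have -> : v = u by lra.
  rewrite subrr mulr0 le_eqVlt; apply/orP; left; apply/eqP.
  transitivity (Int u u (fun=> 0 : R)); last by rewrite Int_cst// mul0r.
  apply: eq_Rintegral => y; rewrite inE/= in_itv/= => uyu.
  by rewrite (_ : y = x) ?subrr ?normr0//; lra.
pose h := v - u; have h0 : 0 < h by rewrite subr_gt0.
have hd1 : 0 < h < d1 by rewrite h0.
have [[al hb hl] cov] := lohi h hd1.
have [lou vhi] := cov u v au ux xv vb (lexx _).
have := Hd h; rewrite h0/= => /(_ (lt_le_trans vd d1d)) /=.
rewrite wE ger0_norm ?meanpow_ge0// => mh.
have sub := cc_sub al hb.
have mabs : measurable_fun (`[a, b]%classic : set (lebesgueR R))
    ((fun y => `|m y - m x|) : lebesgueR R -> R).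
  apply: measurableT_comp; first exact: normr_measurable.
  by apply: measurable_funB; [exact: mm|exact: measurable_cst].
have {}mh : meanpow s h `[x + lo h, x + hi h] (fun y => `|m y - m x|) <= e / 3.
  have mabs' := measurable_funS (measurable_cc a b) sub mabs.
  by have <- := @meanpow_shift _ s h x _ _ (fun y => `|m y - m x|) mabs'; exact: ltW.
have ii := itg_abs (itg_incr x im).
apply: le_trans (Int_mono lou (ltW uv) vhi (itgS al hb ii) _) _ => //.
apply: le_trans (meanpow_le_L1 s1 h0 e30 _ _ _ _ mh) _ => //.
- lra.
- exact: itgS al hb ii.
- exact: itgS al hb (memL_itg_abs_powR x s0 Lm).
rewrite -/h.
have : e / 3 * (x + hi h - (x + lo h) + h) <= e / 3 * (3 * h).
  by rewrite ler_wpM2l ?(ltW e30)//; lra.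
lra.
Qed.

Lemma right_derivate_right_L1_bound s a b m x alpha : a <= x < b -> 1 <= s ->
  memL s a b m -> (upper_right_derivate s m x < alpha%:E)%E ->
  right_L1_bound b m x alpha.
Proof.
move=> /andP[ax xb] s1 Lm /ereal_inf_lt[_ [be /= Hbe <-]]; rewrite lte_fin => be_al.
have s0 : 0 <= s by lra.
have [mm _] := Lm; have im := memL_itg s1 Lm.
apply: (right_L1_bound_le ax im (ltW be_al)) => e e0.
move/littleo_id_right0P: Hbe => Hbe.
have e20 : 0 < e / 2 by lra.
have [d d0 Hd] := Hbe _ e20; exists d => // y /andP[xy yd] yb.
pose h := y - x; have h0 : 0 < h by rewrite subr_gt0.
have := Hd h; rewrite h0/= ltrBlDl => /(_ yd); rewrite ger0_norm ?meanpow_ge0//.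
pose g z := Num.max (m z - m x - be * (z - x)) 0.
have -> : (fun t => Num.max (m (x + t) - m x - be * t) 0) = (fun t => g (x + t)).
  by apply/funext => t; rewrite /g (_ : x + t - x = t)//; ring.
have ig : itg a b g by exact: itg_rb.
have mg := itg_meas (itgS ax yb ig).
have mg' : measurable_fun (`[x + 0, x + h]%classic : set (lebesgueR R)) (g : lebesgueR R -> R).
  by rewrite addr0 (addrC x h) subrK.
have -> := @meanpow_shift _ s h x 0 h g mg'.
rewrite addr0 (addrC x h) subrK => mh.
apply: le_trans (meanpow_le_L1 s1 h0 (mulr_gt0 e20 h0) (ltW xy) _ _ _ mh) _.
- by move=> z _; have [] := pos_ge (m z - m x - be * (z - x)).
- exact: itgS ax yb ig.
- apply: (itgS ax yb); apply: (itg_powR_le (K := `|m x| + `|be| * (b - a)) s0 _ Lm).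
  + apply: addr_ge0 => //; apply: mulr_ge0 => //; lra.
  + exact: itg_meas.
  move=> z /andP[az zb]; have [_ ->] := pos_ge (m z - m x - be * (z - x)).
  rewrite ge_max /=; apply/andP; split; last first.
    apply: addr_ge0 => //; apply: addr_ge0 => //; apply: mulr_ge0 => //; lra.
  have := ler_norm (m z); have := ler_norm (- m x); rewrite normrN.
  have : - (be * (z - x)) <= `|be| * (b - a).
    apply: le_trans (ler_norm _) _; rewrite normrN normrM ler_wpM2l//.
    by rewrite ler_norml; apply/andP; split; lra.
  lra.
by rewrite -/h; lra.
Qed.

(** The argument uses minor functions through these four properties, in which s no
longer occurs. *)
Lemma minor_function_L1 s a b f m : a < b -> 1 <= s -> minor_function s a b f m ->
  [/\ itg a b m, L1_continuous a b m,
    exists2 N : set R, (leb R).-negligible (N : set (lebesgueR R)) &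
      forall x, a < x < b -> ~ N x -> forall alpha, f x < alpha ->
        right_L1_bound b m x alpha &
    exists2 C : set R, countable C & forall x, a < x < b -> ~ C x ->
      exists alpha, right_L1_bound b m x alpha].
Proof.
move=> ab s1 [Lm _ cm aem [C cC Cm]].
have le_upper x : a < x < b ->
    (upper_right_derivate s m x <= upper_derivate s a b m x)%E.
  move=> /andP[ax xb]; rewrite /upper_derivate gt_eqF// lt_eqF//.
  move: (upper_right_derivate _ _ _) (upper_left_derivate _ _ _) => A B.
  by rewrite le_max lexx.
split.
- exact: memL_itg Lm.
- exact: Lcontinuous_L1_continuous Lm cm.
- exists (~` [set x | `[a, b]%classic x -> (upper_derivate s a b m x <= (f x)%:E)%E]) => //.
  move=> x xab /contrapT /= H alpha fal.
  apply: (right_derivate_right_L1_bound (a := a) _ s1 Lm).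
    by case/andP: xab => /ltW ->.
  apply: le_lt_trans (le_upper _ xab) _; apply: le_lt_trans (H _) _; last by rewrite lte_fin.
  by rewrite in_itv/=; case/andP: xab => /ltW -> /ltW.
- exists C => // x xab nC.
  have : (upper_right_derivate s m x < +oo)%E.
    apply: le_lt_trans (le_upper _ xab) _; apply: Cm; split => //.
    by rewrite /= in_itv/=; case/andP: xab => /ltW -> /ltW.
  move=> /ereal_inf_lt[_ [be /= Hbe <-]] _; exists (be + 1).
  apply: (right_derivate_right_L1_bound (a := a) _ s1 Lm).
    by case/andP: xab => /ltW ->.
  apply: (@le_lt_trans _ _ be%:E); last by rewrite lte_fin; lra.
  by apply: ereal_inf_lbound; exists be.
Qed.
End MinorToL1.

(** * A Cantor set with prescribed scales *)

Definition word_union (R : realType) (j : nat) (A : seq bool -> set R) : set R :=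
  \bigcup_(t in [set t | size t = j]) A t.

Lemma word_unionS (R : realType) j (A : seq bool -> set R) :
  word_union j.+1 A =
  word_union j (A \o cons false) `|` word_union j (A \o cons true).
Proof.
apply/seteqP; split=> x.
  by move=> [[|[] t]//= [tj] Ax]; [right|left]; exists t.
by move=> [] [t /= tj Ax]; [exists (false :: t)|exists (true :: t)] => //=; rewrite tj.
Qed.

Lemma word_union0 (R : realType) (A : seq bool -> set R) : word_union 0 A = A [::].
Proof.
apply/seteqP; split=> x; first by move=> [t /= /size0nil ->].
by move=> Ax; exists [::].
Qed.

Lemma measurable_word_union (R : realType) j (A : seq bool -> set R) :
  (forall t, measurable (A t : set (lebesgueR R))) ->
  measurable (word_union j A : set (lebesgueR R)).
Proof.
elim: j A => [|j IH] A mA; first by rewrite word_union0.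
by rewrite word_unionS; apply: measurableU; apply: IH => t; exact: mA.
Qed.

Lemma leb_word_union (R : realType) j (A : seq bool -> set R) (c : R) :
  (forall t, size t = j -> (leb R (A t) <= c%:E)%E) ->
  (leb R (word_union j A) <= (2 ^+ j * c)%:E)%E.
Proof.
elim: j A => [|j IH] A Ac; first by rewrite word_union0 expr0 mul1r Ac.
rewrite word_unionS; apply: le_trans (outer_measureU2 _ _ _) _.
rewrite exprS -mulrA mulr_natl mulr2n EFinD.
by apply: leeD; apply: IH => t tj; apply: Ac; rewrite /= tj.
Qed.

Section Cantor.
Context {R : realType} (L : nat -> R).
Implicit Types (s t : seq bool) (x : R).

(** The left end of the construction interval named by the binary word s: the
letter true at place i moves to the right-hand interval of stage i + 1, at
distance L i - L i.+1 from the left-hand one. *)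
Definition word_point s : R :=
  \sum_(i < size s) (nth false s i)%:R * (L i - L i.+1).

Definition cylinder s : set R :=
  `[word_point s, word_point s + L (size s)]%classic.

Definition gap s : set R :=
  `]word_point s + L (size s).+1, word_point s + L (size s) - L (size s).+1[%classic.

Definition cantor_set : set R := [set x | forall k, word_union k cylinder x].

Lemma word_point_rcons s b : word_point (rcons s b) =
  word_point s + b%:R * (L (size s) - L (size s).+1).
Proof.
rewrite /word_point size_rcons big_ord_recr/= nth_rcons ltnn eqxx; congr (_ + _).
by apply: eq_bigr => i _; rewrite nth_rcons ltn_ord.
Qed.

Context (Lpos : forall k, 0 < L k) (Lsmall : forall k, 8 * L k.+1 <= L k).

Lemma cylinder_rcons s b : cylinder (rcons s b) `<=` cylinder s.
Proof.
move=> x; rewrite /cylinder /= !in_itv/= word_point_rcons size_rcons.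
have := Lpos (size s).+1; have := Lsmall (size s).
by case: b; rewrite ?mul1r ?mul0r => ? ? /andP[? ?]; apply/andP; split; lra.
Qed.

Lemma cylinder_cat s t : cylinder (s ++ t) `<=` cylinder s.
Proof.
elim/last_ind: t => [|t b IH]; first by rewrite cats0.
by move=> x; rewrite -rcons_cat => /cylinder_rcons; exact: IH.
Qed.

Lemma cylinder_take s k : cylinder s `<=` cylinder (take k s).
Proof. by rewrite -{1}(cat_take_drop k s); exact: cylinder_cat. Qed.

Lemma cylinder_inj s t x : size s = size t -> cylinder s x -> cylinder t x -> s = t.
Proof.
elim/last_ind: s t => [|s b IH] t; first by move/esym/size0nil ->.
case/lastP: t => [|t c]; rewrite !size_rcons// => -[st] sx tx.
have {}IH : s = t by by apply: IH => //; [exact: cylinder_rcons sx|exact: cylinder_rcons tx].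
move: sx tx; rewrite -{t st}IH /cylinder/= !in_itv/= !word_point_rcons !size_rcons.
have := Lpos (size s).+1; have := Lsmall (size s).
by case: b; case: c => //; rewrite ?mul1r ?mul0r => ? ? /andP[? ?] /andP[? ?]; exfalso; lra.
Qed.

Lemma cylinder_split s x : cylinder s x ->
  [\/ cylinder (rcons s false) x, gap s x | cylinder (rcons s true) x].
Proof.
rewrite /cylinder /gap/= !in_itv/= !word_point_rcons !size_rcons mul1r mul0r addr0.
move=> /andP[px xp].
have [xl|lx] := leP x (word_point s + L (size s).+1); first by constructor 1; rewrite px.
have [rx|xr] := leP (word_point s + L (size s) - L (size s).+1) x.
  by constructor 3; apply/andP; split; lra.
by constructor 2.
Qed.

Lemma gap_cylinder s : gap s `<=` cylinder s.
Proof.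
move=> x; rewrite /cylinder /gap/= !in_itv/= => /andP[? ?].
by have := Lpos (size s).+1 => ?; apply/andP; split; lra.
Qed.

Lemma gap_cylinder_rcons s b x : gap s x -> ~ cylinder (rcons s b) x.
Proof.
rewrite /cylinder /gap/= !in_itv/= !word_point_rcons !size_rcons.
by case: b; rewrite ?mul1r ?mul0r => /andP[? ?] /andP[? ?]; lra.
Qed.

(** A longer word t would place x in a child of cylinder s, which misses the
gap. *)
Lemma gap_cylinder_size s t x : gap s x -> cylinder t x -> (size t <= size s)%N.
Proof.
move=> sx tx; rewrite leqNgt; apply/negP => st.
have tk : (size s <= size t)%N by exact: ltnW.
have ux := @cylinder_take t (size s) x tx.
have us : take (size s) t = s.
  apply: cylinder_inj ux (gap_cylinder sx); exact: size_takel.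
have := @cylinder_take t (size s).+1 x tx.
by rewrite (take_nth false st) us; exact: gap_cylinder_rcons.
Qed.

Lemma gap_inj s t x : gap s x -> gap t x -> s = t.
Proof.
move=> sx tx; apply: (cylinder_inj (x := x)); [|exact: gap_cylinder..].
apply/eqP; rewrite eqn_leq (gap_cylinder_size tx (gap_cylinder sx)).
exact: gap_cylinder_size sx (gap_cylinder tx).
Qed.

Lemma gap_not_cantor s x : gap s x -> ~ cantor_set x.
Proof.
move=> sx /(_ (size s).+1) [t /= tk tx].
by have := gap_cylinder_size sx tx; rewrite tk ltnn.
Qed.

(** A point that is in no gap can be followed from parent to child for ever. *)
Lemma cantor_or_gap x : cylinder [::] x -> cantor_set x \/ exists s, gap s x.
Proof.
move=> x0; have [[s sx]|ng] := pselect (exists s, gap s x); [by right; exists s|left].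
elim=> [|k [s /= sk sx]]; first by exists [::].
by case: (cylinder_split sx) => [sx'|sx'|sx']; [exists (rcons s false)|
  exfalso; apply: ng; exists s|exists (rcons s true)]; rewrite //= size_rcons sk.
Qed.

Lemma leb_cylinders k : (leb R (word_union k cylinder) <= (2 ^+ k * L k)%:E)%E.
Proof.
apply: leb_word_union => t tk; rewrite /cylinder leb_cc; last by rewrite lerDl ltW.
by rewrite addrC addKr tk.
Qed.

Lemma pow2L k : 2 ^+ k * L k <= 4^-1 ^+ k * L 0.
Proof.
elim: k => [|k IH]; first by rewrite !expr0.
rewrite !exprS; have := Lsmall k => Lk.
have : 2 ^+ k * L k.+1 <= 2 ^+ k * (L k / 8) by rewrite ler_wpM2l ?exprn_ge0//; lra.
lra.
Qed.

Lemma measurable_cylinders k :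
  measurable (word_union k cylinder : set (lebesgueR R)).
Proof. by apply: measurable_word_union => t; exact: measurable_cc. Qed.

Lemma cantor_set_negligible : (leb R).-negligible (cantor_set : set (lebesgueR R)).
Proof.
have mC : measurable (cantor_set : set (lebesgueR R)).
  rewrite (_ : cantor_set = \bigcap_k word_union k cylinder).
    by apply: bigcapT_measurable => k; exact: measurable_cylinders.
  by apply/seteqP; split => x Hx k => [_|]; exact: Hx.
exists cantor_set; split=> //; apply/eqP; rewrite eq_le measure_ge0 andbT.
have cvg0 : (4^-1 ^+ k * L 0 : R) @[k --> \oo] --> (0 : R).
  rewrite -[X in _ --> X](mul0r (L 0)); apply: cvgM; last exact: cvg_cst.
  by apply: cvg_expr; rewrite gtr0_norm; lra.
apply/lee_addgt0Pr => e e0; rewrite add0e.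
move/cvgr0Pnorm_lt : cvg0 => /(_ _ e0)[k _ /(_ k (leqnn k)) /= ke].
apply: (@le_trans _ _ (leb R (word_union k cylinder))).
  by apply: le_outer_measure => x; apply.
apply: le_trans (leb_cylinders k) _; rewrite lee_fin.
by apply: le_trans (pow2L k) (le_trans (ler_norm _) (ltW ke)).
Qed.
End Cantor.

(** * Scales, slopes and a smooth spike *)

(** Two demands compete: L k.+1 has to be so small with respect to L k that the
r-mean of a spike over an interval of length comparable with L k is summable,
and yet so large that (L k)^2 is negligible with respect to it.  The choice
L k = 2^-(c k^2) with c large in terms of r meets both, since then
L k.+1 / L k = 2^-(c (2 k + 1)) tends to 0 more slowly than L k. *)
Lemma exists_scales (R : realType) (r : R) : 1 <= r -> exists L : nat -> R,
  [/\ L 0%N = 1, forall k, 0 < L k, forall k, 8 * L k.+1 <= L k,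
      forall k, 2 ^+ (k + 4) * L k.+1 / L k <= (8^-1 ^+ k) `^ r &
      forall e, 0 < e -> exists K, forall k, (K <= k)%N -> L k ^+ 2 <= e * L k.+1].
Proof.
move=> r1.
(* the exponent c (2 k + 1) must exceed (k + 4) + 3 k r *)
pose c := (5 + 2 * (Num.truncn r).+1)%N; pose h : R := 2^-1.
have h0 : 0 < h by rewrite /h; lra.
have h1 : h <= 1 by rewrite /h; lra.
pose L k : R := h ^+ (c * k ^ 2).
have Lp k : 0 < L k by rewrite exprn_gt0.
have LS k : L k.+1 = h ^+ (c * (2 * k + 1)) * L k.
  by rewrite /L -exprD; congr (_ ^+ _); lia.
have h2 n : 2 ^+ n * h ^+ n = 1 by rewrite -exprMn divff ?expr1n.
exists L; split=> //.
- by rewrite /L muln0.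
- move=> k; rewrite LS mulrA ler_piMl ?(ltW (Lp k))//.
  have -> : 8 = 2 ^+ 3 :> R by rewrite -natrX.
  have -> : (c * (2 * k + 1) = 3 + (c * (2 * k + 1) - 3))%N by rewrite /c; lia.
  by rewrite exprD mulrA h2 mul1r exprn_ile1// ltW.
- move=> k; rewrite LS mulrA mulfK ?gt_eqF//.
  pose N := (Num.truncn r).+1.
  apply: (@le_trans _ _ ((8^-1 ^+ k) `^ N%:R)); last first.
    apply: ger_powR; last by rewrite ltW// truncnS_gt.
    by rewrite exprn_gt0 ?exprn_ile1//; lra.
  rewrite powR_mulrn ?exprn_ge0// -exprM.
  have -> : (8^-1 : R) = h ^+ 3 by rewrite /h exprVn -natrX.
  rewrite -exprM.
  have -> : (c * (2 * k + 1) = (k + 4) + (c * (2 * k + 1) - (k + 4)))%N.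
    by rewrite /c; lia.
  rewrite (exprD h) mulrA h2 mul1r ler_wiXn2l ?(ltW h0)//.
  by rewrite /c /N; nia.
- move=> e e0.
  have cvg0 : (h ^+ k) @[k --> \oo] --> (0 : R).
    by apply: cvg_expr; rewrite gtr0_norm// /h; lra.
  move/cvgr0Pnorm_lt : cvg0 => /(_ _ e0)[K _ HK].
  exists (K + 4)%N => k Kk; rewrite LS expr2 mulrA ler_pM2r//.
  have kk : (c * k ^ 2 = c * (2 * k + 1) + (c * k ^ 2 - c * (2 * k + 1)))%N.
    by rewrite subnKC// leq_mul2l; apply/orP; right; nia.
  rewrite /L kk exprD mulrC ler_pM2r ?exprn_gt0//.
  have := HK K (leqnn K); rewrite /= ger0_norm ?exprn_ge0 ?(ltW h0)// => /ltW; apply: le_trans.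
  rewrite ler_wiXn2l ?(ltW h0)// -mulnBr.
  by apply: leq_trans (_ : 1 * (k ^ 2 - (2 * k + 1)) <= _)%N; nia.
Qed.

(** Differentiability at x in the form in which it enters estimates of means over
windows. *)
Definition has_slope (R : realType) (F : R -> R) (x alpha : R) : Prop :=
  forall e : R, 0 < e -> exists2 d : R, 0 < d &
    forall y, `|y - x| < d -> `|F y - F x - alpha * (y - x)| <= e * `|y - x|.

Definition hat (R : realType) (u : R) : R := Num.max (1 - u ^+ 2) 0 ^+ 2.

Section Hat.
Context {R : realType}.

Lemma hat_ge0 (u : R) : 0 <= hat u. Proof. exact: sqr_ge0. Qed.

Lemma hat_le1 (u : R) : hat u <= 1.
Proof.
rewrite /hat exprn_ile1// ?le_max ?lexx ?orbT// ge_max ler01 andbT.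
by have := sqr_ge0 u; lra.
Qed.

Lemma hat_eq0 (u : R) : 1 <= `|u| -> hat u = 0.
Proof.
move=> u1; rewrite /hat (_ : Num.max _ _ = 0) ?expr0n//; apply/max_idPr.
by rewrite -real_normK ?num_real// subr_le0 exprn_ege1.
Qed.

Lemma hat_ge_half (u : R) : `|u| <= 2^-1 -> 2^-1 <= hat u.
Proof.
move=> u1; have : u ^+ 2 <= 4^-1.
  rewrite -real_normK ?num_real// (_ : 4^-1 = 2^-1 ^+ 2).
    by rewrite lerXn2r ?nnegrE.
  by rewrite exprVn -natrX.
rewrite /hat => u2; rewrite max_l; nra.
Qed.

Lemma pos_sqr_quad (a b : R) :
  `|Num.max b 0 ^+ 2 - Num.max a 0 ^+ 2 - 2 * Num.max a 0 * (b - a)| <= (b - a) ^+ 2.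
Proof.
have sq := sqr_ge0 (b - a); have sa := sqr_ge0 a; have sb := sqr_ge0 b.
rewrite ler_norml; case: (leP a 0) => a0; case: (leP b 0) => b0; apply/andP; split.
all: try have ab : a * b <= 0 by (nra || rewrite mulr_le0_ge0//; lra).
all: nra.
Qed.

Lemma has_slope_quad (F : R -> R) x alpha (K : R) :
  (forall y, `|y - x| < 1 -> `|F y - F x - alpha * (y - x)| <= K * (y - x) ^+ 2) ->
  has_slope F x alpha.
Proof.
move=> H e e0; pose M := `|K| + 1; have M0 : 0 < M by rewrite /M; have := normr_ge0 K; lra.
exists (Num.min 1 (e / M)); first by rewrite lt_min ltr01 divr_gt0.
move=> y; rewrite lt_min ltr_pdivlMr// => /andP[y1 ye].
apply: le_trans (H y y1) _; rewrite -real_normK ?num_real// expr2 mulrA ler_wpM2r//.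
apply: le_trans (_ : M * `|y - x| <= _); last by rewrite mulrC ltW.
by rewrite ler_wpM2r// /M; have := ler_norm K; lra.
Qed.

(** The square of the positive part has a Lipschitz derivative, so the first-order
remainder of the profile is quadratic. *)
Lemma has_slope_hat (c w x : R) : 0 < w ->
  exists alpha, has_slope (fun y => hat ((y - c) / w)) x alpha.
Proof.
move=> w0; pose u y := 1 - ((y - c) / w) ^+ 2; pose p := Num.max (u x) 0.
have uB y : u y - u x = - (2 * (x - c) / w ^+ 2) * (y - x) - (y - x) ^+ 2 / w ^+ 2.
  by rewrite /u; field; rewrite gt_eqF.
pose A := - (2 * (x - c) / w ^+ 2); pose B := (w ^+ 2)^-1.
have B0 : 0 <= B by rewrite invr_ge0 sqr_ge0.
have p0 : 0 <= p by rewrite le_max lexx orbT.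
exists (2 * p * A); apply: (has_slope_quad (K := 2 * p * B + (`|A| + B) ^+ 2)) => y y1.
have := pos_sqr_quad (u x) (u y); rewrite -/p.
rewrite /hat -/(u x) -/(u y) -/p uB -/A -/B.
set z := y - x in y1 *; set D := Num.max (u y) 0 ^+ 2 - p ^+ 2.
move=> H.
have z1 : `|A * z - z ^+ 2 * B| <= (`|A| + B) * `|z|.
  apply: le_trans (ler_normB _ _) _; rewrite !normrM (ger0_norm B0) mulrDl lerD2l.
  by rewrite mulrC ler_wpM2l// ler_piMl// ltW.
have z2 : (A * z - z ^+ 2 * B) ^+ 2 <= (`|A| + B) ^+ 2 * z ^+ 2.
  rewrite -[leLHS]real_normK ?num_real// -[X in _ <= _ * X]real_normK ?num_real// -exprMn.
  by apply: lerXn2r => //; apply: mulr_ge0 => //; exact: addr_ge0.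
have -> : D - 2 * p * A * z =
   (D - 2 * p * (A * z - z ^+ 2 * B)) - 2 * p * B * z ^+ 2 by ring.
apply: le_trans (ler_normB _ _) _.
rewrite (ger0_norm (_ : 0 <= 2 * p * B * z ^+ 2)); last first.
  by apply: mulr_ge0; [do 2 apply: mulr_ge0 => //|exact: sqr_ge0].
by rewrite [leRHS]mulrDl; lra.
Qed.

Lemma has_slope_continuous (F : R -> R) x alpha : has_slope F x alpha ->
  {for x, continuous F}.
Proof.
move=> H; apply/cvgrPdist_lt => e e0.
have [d d0 Hd] := H 1 ltr01; pose M := 2 + `|alpha|.
have M0 : 0 < M by rewrite /M; have := normr_ge0 alpha; lra.
near=> y.
have yd : `|y - x| < d by near: y; apply: (cvgr_distC_lt id); [exact: cvg_id|].
have ye : `|y - x| < e / M.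
  by near: y; apply: (cvgr_distC_lt id); [exact: cvg_id|exact: divr_gt0].
have := Hd y yd; rewrite mul1r => H1.
have -> : F x - F y = - (F y - F x - alpha * (y - x)) - alpha * (y - x) by ring.
apply: le_lt_trans (ler_normB _ _) _; rewrite normrN normrM.
by move: ye; rewrite ltr_pdivlMr// /M; have := normr_ge0 (y - x); lra.
Unshelve. all: by end_near. Qed.

Lemma has_slope_near (F G : R -> R) x alpha : (\forall y \near x, F y = G y) ->
  has_slope G x alpha -> has_slope F x alpha.
Proof.
move=> /nbhs_ballP[d /= d0 FG] H e e0; have [d' d'0 Hd'] := H e e0.
exists (Num.min d d'); first by rewrite lt_min d0.
have FGx : F x = G x by apply: FG; exact: ballxx.
move=> y; rewrite lt_min => /andP[yd yd']; rewrite FGx FG ?Hd'//.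
by rewrite /ball/= distrC.
Qed.

Lemma has_slope_right_L1_bound (F : R -> R) b x alpha beta :
  has_slope F x alpha -> alpha < beta -> right_L1_bound b F x beta.
Proof.
move=> H ab; apply: right_L1_bound_pointwise.
have [|d d0 Hd] := H (beta - alpha); first by lra.
exists d => // y /andP[xy yd]; have := Hd y.
rewrite gtr0_norm ?subr_gt0// ltrBlDl => /(_ yd); rewrite ler_norml => /andP[_]; lra.
Qed.
End Hat.

(** * The sum of the spikes *)

Section Spikes.
Context {R : realType} (L : nat -> R).
Implicit Types (s t : seq bool) (x y : R).

Definition midgap s : R := word_point L s + L (size s) / 2.

Definition spike s : set R :=
  `[midgap s - L (size s).+1, midgap s + L (size s).+1]%classic.

Definition hat_at s x : R := hat ((x - midgap s) / L (size s).+1).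

(** At most one gap contains a given point, so the sum of the profiles of all
gaps reduces to a choice. *)
Definition spikes x : R :=
  if pselect (exists s, gap L s x) is left H then hat_at (projT1 (cid H)) x else 0.

Context (L0 : L 0%N = 1) (Lpos : forall k, 0 < L k)
  (Lsmall : forall k, 8 * L k.+1 <= L k).

Lemma spike_gap s : spike s `<=` gap L s.
Proof.
move=> x; rewrite /spike /gap /midgap /= !in_itv/= => /andP[? ?].
by have := Lsmall (size s); have := Lpos (size s).+1 => ? ?; apply/andP; split; lra.
Qed.

Lemma spikes_gap s x : gap L s x -> spikes x = hat_at s x.
Proof.
move=> sx; rewrite /spikes; case: pselect => [H|]; last by case; exists s.
by rewrite (gap_inj Lpos Lsmall (projT2 (cid H)) sx).
Qed.

Lemma spikes_no_gap x : ~ (exists s, gap L s x) -> spikes x = 0.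
Proof. by rewrite /spikes; case: pselect. Qed.

Lemma spikes_cantor x : cantor_set L x -> spikes x = 0.
Proof.
move=> Cx; apply: spikes_no_gap => -[s sx].
exact: gap_not_cantor Lpos Lsmall s x sx Cx.
Qed.

Lemma spikes_ge0 x : 0 <= spikes x.
Proof. by rewrite /spikes; case: pselect => // H; exact: hat_ge0. Qed.

Lemma spikes_le1 x : spikes x <= 1.
Proof. by rewrite /spikes; case: pselect => [H|_]; [exact: hat_le1|exact: ler01]. Qed.

Lemma hat_at_neq0 s x : hat_at s x != 0 -> spike s x.
Proof.
move=> nz; have lt1 : `|(x - midgap s) / L (size s).+1| < 1.
  by rewrite ltNge; apply: contra nz => /hat_eq0 /eqP.
move: lt1; rewrite normrM normfV (gtr0_norm (Lpos _)) ltr_pdivrMr// mul1r ltr_norml.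
by move=> /andP[? ?]; rewrite /spike/= in_itv/=; apply/andP; split; lra.
Qed.

Lemma spikes_neq0 x : spikes x != 0 -> exists s, spike s x.
Proof.
move=> nz; have [[s sx]|ng] := pselect (exists s, gap L s x).
  by exists s; apply: hat_at_neq0; rewrite -(spikes_gap sx).
by move: nz; rewrite spikes_no_gap// eqxx.
Qed.

Lemma spikes_half s x : `|x - midgap s| <= L (size s).+1 / 2 -> 2^-1 <= spikes x.
Proof.
move=> xs; have Lp := Lpos (size s).+1.
have sx : spike s x.
  by move: xs; rewrite ler_norml /spike/= in_itv/= => /andP[? ?]; apply/andP; split; lra.
rewrite (spikes_gap (spike_gap sx)); apply: hat_ge_half.
by rewrite normrM normfV (gtr0_norm Lp) ler_pdivrMr// mulrC.
Qed.

Lemma spikes_gap0 s x : gap L s x -> ~ spike s x -> spikes x = 0.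
Proof.
move=> sx nsx; rewrite (spikes_gap sx); apply/eqP; rewrite -[_ == _]negbK.
by apply/negP => /hat_at_neq0.
Qed.

Lemma open_gap s : open (gap L s).
Proof. exact: interval_open. Qed.

Lemma spikes_slope s x : gap L s x -> exists alpha, has_slope spikes x alpha.
Proof.
move=> sx; have [alpha H] := has_slope_hat (midgap s) x (Lpos (size s).+1).
exists alpha; apply: has_slope_near H.
have : nbhs x (gap L s) by apply: open_nbhs_nbhs; split => //; exact: open_gap.
by apply: filterS => y; exact: spikes_gap.
Qed.

Definition gaps : set R := \bigcup_s gap L s.

Lemma spikes_measurable : measurable_fun (setT : set R) spikes.
Proof.
have oU : open gaps by apply: bigcup_open => s _; exact: open_gap.
have mU := open_measurable oU.
rewrite -(setUv gaps); apply/measurable_funU => //; first exact: measurableC.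
split.
  apply: open_continuous_measurable_fun => // x; rewrite inE => -[s _ sx].
  by have [alpha H] := spikes_slope sx; exact: has_slope_continuous H.
apply: (@eq_measurable_fun _ _ _ _ _ (fun=> 0 : R) spikes); last exact: measurable_cst.
move=> x; rewrite inE => nx; rewrite spikes_no_gap// => -[s sx].
by apply: nx; exists s.
Qed.

Lemma spikes_leb_measurable (D : set R) : measurable D ->
  measurable_fun (D : set (lebesgueR R)) (spikes : lebesgueR R -> R).
Proof.
by move=> mD; apply: borel_fun_leb => //; exact: measurable_funS spikes_measurable.
Qed.

Lemma itg_spikes (a b : R) : itg a b spikes.
Proof.
apply: (@itg_bounded _ _ _ _ 1).
  by apply: spikes_leb_measurable; exact: measurable_itv.
by move=> y _; rewrite ger0_norm ?spikes_ge0// spikes_le1.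
Qed.

Lemma spikes_powR_le1 (r x : R) : 0 <= r -> spikes x `^ r <= 1.
Proof.
move=> r0; have <- : 1 `^ r = 1 :> R by rewrite powR1.
apply: ge0_ler_powR => //.
- by rewrite nnegrE spikes_ge0.
- by rewrite nnegrE ler01.
- exact: spikes_le1.
Qed.

Lemma memL_spikes (r a b : R) : 0 <= r -> memL r a b spikes.
Proof.
move=> r0.
have ms : measurable_fun (`[a, b]%classic : set (lebesgueR R)) (spikes : lebesgueR R -> R).
  by apply: spikes_leb_measurable; exact: measurable_itv.
split => //.
have : itg a b (fun y => `|spikes y| `^ r).
  apply: (@itg_bounded _ _ _ _ 1).
    apply: (measurableT_comp (measurable_powR r)).
    by apply: measurableT_comp ms; exact: normr_measurable.
  move=> y _; rewrite (ger0_norm (spikes_ge0 y)) ger0_norm ?powR_ge0//.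
  exact: spikes_powR_le1.
move=> /integrableP[_]; apply: le_lt_trans; rewrite le_eqVlt; apply/orP; left; apply/eqP.
by apply: eq_integral => y _ /=; rewrite [in RHS]ger0_norm// powR_ge0.
Qed.

End Spikes.

(** * The sum of the spikes is an HK primitive *)

Section HK.
Context {R : realType}.
Implicit Types (r l a b x alpha : R) (F : R -> R).

Lemma meanpow_le r l (k : R) (D : set R) (g : R -> R) : 1 <= r -> 0 < l -> 0 <= k ->
  Rintegral (leb R) D (fun t => g t `^ r) <= l * k `^ r -> meanpow r l D g <= k.
Proof.
move=> r1 l0 k0 H; rewrite /meanpow.
have r0 : r != 0 by rewrite gt_eqF//; lra.
have I0 : 0 <= Rintegral (leb R) D (fun t => g t `^ r).
  by apply: Rintegral_ge0 => t _; exact: powR_ge0.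
rewrite -[leRHS]powRr1// -(mulfV r0) powRrM.
have le0 : 0 <= l^-1 by rewrite invr_ge0 ltW.
apply: ge0_ler_powR.
- by rewrite invr_ge0; lra.
- by rewrite nnegrE mulr_ge0.
- by rewrite nnegrE powR_ge0.
by rewrite ler_pdivrMl.
Qed.

(** On a window of radius h the error of the linear approximation is at most
(e / 2) h pointwise, and the window has length at most 2 h. *)
Lemma slope_Lderiv r a b F x alpha : 1 <= r -> measurable_fun (setT : set R) F ->
  has_slope F x alpha -> Lderiv_at r a b F x alpha.
Proof.
move=> r1 mF HF; apply/littleo_id_right0P => e e0.
have [|d d0 Hd] := HF (e / 2); first by lra.
exists d => // h /andP[h0 hd]; rewrite ger0_norm ?meanpow_ge0//.
have [lo [hi [wE lo_h hi_h lohi lohi2]]] : exists lo hi : R,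
   [/\ window a b x h = `[lo, hi]%classic, - h <= lo, hi <= h, lo <= hi & hi - lo <= 2 * h].
  rewrite /window; case: ifP => _; [exists 0, h|
    case: ifP => _; [exists (- h), 0|exists (- h), h]];
  by split=> //; lra.
rewrite wE; apply: meanpow_le => //; first by rewrite mulr_ge0// ltW.
pose k := e / 2 * h.
have k0 : 0 <= k by rewrite /k mulr_ge0//; lra.
have mg : measurable_fun (setT : set R) (fun t => `|F (x + t) - F x - alpha * t| `^ r).
  apply: (measurableT_comp (measurable_powR r)).
  apply: measurableT_comp; first exact: normr_measurable.
  apply: measurable_funB.
    2: by apply: measurable_funM; [exact: measurable_cst|exact: measurable_id].
  apply: measurable_funB; last exact: measurable_cst.
  apply: measurableT_comp mF _.
  by apply: measurable_funD; [exact: measurable_cst|exact: measurable_id].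
have gk t : lo <= t <= hi -> `|F (x + t) - F x - alpha * t| `^ r <= k `^ r.
  move=> /andP[lt th]; have th' : `|t| <= h by rewrite ler_norml; apply/andP; split; lra.
  apply: ge0_ler_powR; rewrite ?nnegrE//; first lra.
  have := Hd (x + t); rewrite (_ : x + t - x = t); last by ring.
  move=> /(_ (le_lt_trans th' hd)) H; apply: le_trans H _.
  by rewrite /k ler_wpM2l//; lra.
apply: (@le_trans _ _ (Int lo hi (fun=> k `^ r))).
  apply: Int_le; [|exact: itg_cst|exact: gk].
  apply: (@itg_bounded _ _ _ _ (k `^ r)).
    apply: borel_fun_leb; first exact: measurable_itv.
    exact: measurable_funS mg.
  by move=> y ylh; rewrite ger0_norm ?powR_ge0//; exact: gk.
rewrite Int_cst//.
have : 2 * k `^ r <= (e * h) `^ r.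
  have -> : e * h = 2 * k by rewrite /k; lra.
  by apply: le1r_powRZ => //; lra.
have := powR_ge0 k r => kr0 H.
apply: (@le_trans _ _ (k `^ r * (2 * h))); first by rewrite ler_wpM2l.
by have := ler_wpM2l (ltW h0) H; lra.
Qed.

Context (L : nat -> R) (r : R) (r1 : 1 <= r) (L0 : L 0%N = 1) (Lpos : forall k, 0 < L k)
  (Lsmall : forall k, 8 * L k.+1 <= L k)
  (Lavg : forall k, 2 ^+ (k + 4) * L k.+1 / L k <= (8^-1 ^+ k) `^ r).

Let F := spikes L.
Let V k := word_union k (cylinder L).
Let Sp k := word_union k (spike L).

Lemma L_nonincreasing i j : (i <= j)%N -> L j <= L i.
Proof.
elim: j => [|j IH]; first by rewrite leqn0 => /eqP ->.
rewrite leq_eqVlt => /predU1P[->//|]; rewrite ltnS => /IH.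
by have := Lsmall j; have := Lpos j.+1; lra.
Qed.

Lemma leb_spikes k : (leb R (Sp k `|` V k.+1) <= (2 ^+ (k + 2) * L k.+1)%:E)%E.
Proof.
apply: le_trans (outer_measureU2 _ _ _) _.
have -> : 2 ^+ (k + 2) * L k.+1 = 2 ^+ k * (2 * L k.+1) + 2 ^+ k.+1 * L k.+1 :> R.
  by rewrite addn2 !exprS; ring.
rewrite EFinD; apply: leeD; last exact: leb_cylinders.
apply: leb_word_union => t tk; rewrite /spike leb_cc tk; last by have := Lpos k.+1; lra.
by rewrite lee_fin; lra.
Qed.

Lemma spike_cylinder s : spike L s `<=` cylinder L s.
Proof. by move=> x /(spike_gap Lpos Lsmall); exact: (gap_cylinder Lpos). Qed.

Lemma spikes_covered (k : nat) (c d : R) :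
  (forall s y, c <= y <= d -> spike L s y -> (k <= size s)%N) ->
  forall y, c <= y <= d -> F y != 0 -> (Sp k `|` V k.+1) y.
Proof.
move=> kmin y ycd /(spikes_neq0 Lpos Lsmall)[s sy].
have := kmin s y ycd sy; rewrite leq_eqVlt => /predU1P[ks|ks].
  by left; exists s.
right; exists (take k.+1 s); first by rewrite /= size_takel.
by apply: (cylinder_take Lpos Lsmall); exact: spike_cylinder.
Qed.

(** If [c, d] meets no spike, its mean is 0; otherwise k is the least stage of a
spike that it meets.  The interval then
contains a component of the gap minus the spike, so that d - c and its part in
V k have measure at least L k / 4, while F is carried by the spikes of stage k
and by V k.+1. *)
Lemma interval_mean_le (c d x : R) (K : nat) : c <= x <= d -> cantor_set L x ->
  c < d -> d - c <= L K / 8 ->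
  exists2 k, (K <= k)%N & meanpow r (d - c) `[c, d] (fun y => `|F y - F x|) <=
    8^-1 ^+ k * (8 / L k) * fine (leb R (`]c, d[%classic `&` V k)).
Proof.
move=> xcd Cx cd dK; have Fx0 : F x = 0 by exact: spikes_cantor.
have fin A : (leb R (`]c, d[%classic `&` A) <= (d - c)%:E)%E.
  by rewrite -(leb_oo (ltW cd)); apply: le_outer_measure; exact: subIsetl.
have rn0 : r != 0 by apply: lt0r_neq0; exact: lt_le_trans ltr01 r1.
have coef0 k : 0 <= 8^-1 ^+ k * (8 / L k) by rewrite mulr_ge0 ?exprn_ge0 ?divr_ge0// ltW.
have [[s0 [y0 [y0cd s0y0]]]|none] := pselect (exists s y, c <= y <= d /\ spike L s y);
    last first.
  exists K => //; apply: (@le_trans _ _ 0); last first.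
    by apply: mulr_ge0 (coef0 K) _; rewrite fine_ge0//; exact: outer_measure_ge0.
  apply: meanpow_le => //; first by rewrite subr_gt0.
  rewrite (powR0 rn0) mulr0.
  rewrite (_ : Rintegral _ _ _ = Int c d (fun=> 0)); first by rewrite Int_cst ?mul0r// ltW.
  apply: eq_Rintegral => y; rewrite inE/= in_itv/= => ycd.
  rewrite Fx0 subr0 (_ : F y = 0) ?normr0 ?(powR0 rn0)//.
  apply/eqP; rewrite -[_ == _]negbK; apply/negP => /(spikes_neq0 Lpos Lsmall)[s sy].
  by apply: none; exists s, y.
have [k [[s [sk [y [ycd sy]]]] kmin]] : exists k,
    (exists s, size s = k /\ exists y, c <= y <= d /\ spike L s y) /\
    (forall s y, c <= y <= d -> spike L s y -> (k <= size s)%N).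
  pose Q k := `[< exists s, size s = k /\ exists y, c <= y <= d /\ spike L s y >].
  have exQ : exists k, Q k.
    by exists (size s0); apply/asboolP; exists s0; split=> //; exists y0.
  case: (ex_minnP exQ) => k /asboolP Qk kmin; exists k; split=> // s y ycd sy.
  by apply: kmin; apply/asboolP; exists s; split=> //; exists y.
have Lk := Lpos k; have Lk1 := Lpos k.+1; have Lsm := Lsmall k.
(* the part of the gap between the spike and the Cantor point x *)
have [u [v [cu uv vd uvk uvJ]]] : exists u v : R,
   [/\ c <= u, u <= v, v <= d, L k / 4 <= v - u & `]u, v[%classic `<=` cylinder L s].
  have nsx : ~ gap L s x by move=> sx; exact: gap_not_cantor Lpos Lsmall s x sx Cx.
  move: sy; rewrite /spike /midgap/= in_itv/= sk => /andP[sy1 sy2].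
  move: ycd xcd => /andP[cy yd] /andP[cx xd].
  have [xu|ux] := leP x (word_point L s + L k.+1).
    exists (word_point L s + L k.+1), (word_point L s + L k / 2 - L k.+1).
    split; [lra|lra|lra|lra|].
    by move=> z; rewrite /cylinder/= !in_itv/= sk => /andP[? ?]; apply/andP; split; lra.
  have vx : word_point L s + L k - L k.+1 <= x.
    rewrite leNgt; apply/negP => xv; apply: nsx.
    by rewrite /gap/= in_itv/= sk ux.
  exists (word_point L s + L k / 2 + L k.+1), (word_point L s + L k - L k.+1).
  split; [lra|lra|lra|lra|].
  by move=> z; rewrite /cylinder/= !in_itv/= sk => /andP[? ?]; apply/andP; split; lra.
exists k.
  rewrite leqNgt; apply/negP => /ltnW /L_nonincreasing; lra.
have ge_leb : L k / 4 <= fine (leb R (`]c, d[%classic `&` V k)).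
  rewrite -lee_fin fineK; last first.
    rewrite ge0_fin_numE; last exact: outer_measure_ge0.
    exact: le_lt_trans (fin _) (ltry _).
  apply: le_trans (_ : ((v - u)%:E <= _)%E); first by rewrite lee_fin.
  rewrite -(leb_oo uv); apply: le_outer_measure => z zuv; split.
    by move: zuv; rewrite /= !in_itv/= => /andP[? ?]; apply/andP; split; lra.
  by exists s => //; exact: uvJ.
apply: (@le_trans _ _ (8^-1 ^+ k)); last first.
  have : 8^-1 ^+ k * (8 / L k) * (L k / 4) <=
      8^-1 ^+ k * (8 / L k) * fine (leb R (`]c, d[%classic `&` V k)).
    by rewrite ler_wpM2l.
  apply: le_trans; rewrite (_ : _ * (L k / 4) = 2 * 8^-1 ^+ k); last by field; rewrite gt_eqF.
  by rewrite ler_peMl ?exprn_ge0//; lra.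
apply: meanpow_le => //; first by rewrite subr_gt0.
have mS : measurable (Sp k `|` V k.+1 : set (lebesgueR R)).
  by apply: measurableU; apply: measurable_word_union => t; exact: measurable_cc.
have r0 : 0 <= r by exact: le_trans ler01 r1.
have key : Int c d (fun y => `|F y - F x| `^ r) <= fine (leb R (Sp k `|` V k.+1)).
  have covS := spikes_covered kmin.
  have i1 : itg c d (\1_(Sp k `|` V k.+1) : R -> R).
    apply: (@itg_bounded _ _ _ _ 1); first exact: measurable_indic.
    by move=> z _; rewrite indicE ger0_norm// lern1 leq_b1.
  have bnd z : c <= z <= d -> `|F z - F x| `^ r <= \1_(Sp k `|` V k.+1) z.
    move=> zcd; rewrite Fx0 subr0 indicE.
    have [Fz|Fz] := eqVneq (F z) 0.
      by rewrite Fz normr0 (powR0 rn0) ler0n.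
    rewrite mem_set; last exact: covS.
    by rewrite ger0_norm ?spikes_ge0// spikes_powR_le1.
  apply: (@le_trans _ _ (Int c d (\1_(Sp k `|` V k.+1) : R -> R))).
    apply: Int_le => //; apply: (itg_le i1).
      apply: (measurableT_comp (measurable_powR r)).
      apply: measurableT_comp; first exact: normr_measurable.
      apply: measurable_funB; last exact: measurable_cst.
      by apply: spikes_leb_measurable => //; exact: measurable_itv.
    by move=> z zcd; rewrite powR_ge0/= bnd.
  have le : (leb R ((Sp k `|` V k.+1) `&` `[c, d]%classic) <= leb R (Sp k `|` V k.+1))%E.
    by apply: le_outer_measure; exact: subIsetl.
  have lt : (leb R (Sp k `|` V k.+1) < +oo)%E.
    exact: le_lt_trans (leb_spikes _) (ltry _).
  rewrite /Rintegral integral_indic//; last exact: measurable_cc.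
  apply: fine_le => //; rewrite ge0_fin_numE; try exact: outer_measure_ge0; last exact: lt.
  exact: le_lt_trans le lt.
apply: le_trans key _.
apply: (@le_trans _ _ (2 ^+ (k + 2) * L k.+1)).
  rewrite -lee_fin fineK ?leb_spikes// ge0_fin_numE; last exact: outer_measure_ge0.
  exact: le_lt_trans (leb_spikes _) (ltry _).
apply: (@le_trans _ _ (L k / 4 * (2 ^+ (k + 4) * L k.+1 / L k))).
  rewrite (_ : L k / 4 * _ = 2 ^+ (k + 2) * L k.+1)//.
  by rewrite !exprD; field; rewrite gt_eqF.
have p0 : 0 <= (8^-1 ^+ k) `^ r by exact: powR_ge0.
apply: (@le_trans _ _ (L k / 4 * (8^-1 ^+ k) `^ r)).
  by rewrite ler_wpM2l ?Lavg//; lra.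
by rewrite ler_wpM2r//; lra.
Qed.

(** The bounds on the single intervals are turned into measures of disjoint
subsets of V k, which has measure at most 2^k L k. *)
Lemma spikes_AC : AC_on r 0 1 F (cantor_set L).
Proof.
move=> eps eps0.
have cvg0 : (4^-1 ^+ k * 16 : R) @[k --> \oo] --> (0 : R).
  rewrite -[X in _ --> X](mul0r 16); apply: cvgM; last exact: cvg_cst.
  by apply: cvg_expr; rewrite gtr0_norm; lra.
move/cvgr0Pnorm_lt : cvg0 => /(_ _ eps0)[K _ /(_ K (leqnn K)) /= Keps].
have {}Keps := le_lt_trans (ler_norm _) Keps.
(* length < L K / 8 rules out all spikes of a stage below K *)
exists (fun=> L K / 16); split=> [x _|n c d x cd tcd Ex sub]; first by rewrite divr_gt0.
pose beta i k : R := 8^-1 ^+ k * (8 / L k) * fine (leb R (`]c i, d i[%classic `&` V k)).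
have beta0 i k : 0 <= beta i k.
  rewrite /beta mulr_ge0 ?fine_ge0 ?outer_measure_ge0//.
  by rewrite mulr_ge0 ?exprn_ge0 ?divr_ge0// ltW.
have ex_k i : exists k, (K <= k)%N /\
    meanpow r (d i - c i) `[c i, d i] (fun y => `|F y - F (x i)|) <= beta i k.
  have [ac cdi db] := cd i; have [Cx xcd] := Ex i.
  have lK : d i - c i <= L K / 8.
    have := sub i (c i); have := sub i (d i); rewrite /= !in_itv/= !lexx (ltW cdi)/=.
    by move=> /(_ isT)/andP[? ?] /(_ isT)/andP[? ?]; lra.
  by have [k Kk Hk] := interval_mean_le xcd Cx cdi lK; exists k.
have [k Hk] := choice ex_k.
pose K' := (\max_(i < n) k i).+1.
apply: (@le_lt_trans _ _ (\sum_(i < n) \sum_(K <= j < K') beta i j)).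
  apply: ler_sum => i _; have [Kk] := Hk i; move=> H; apply: le_trans H _.
  have kK' : (k i < K')%N by rewrite ltnS; exact: leq_bigmax.
  rewrite (big_cat_nat Kk (ltnW kK'))/= (big_ltn kK').
  have : 0 <= \sum_(K <= j < k i) beta i j by rewrite sumr_ge0.
  have : 0 <= \sum_((k i).+1 <= j < K') beta i j by rewrite sumr_ge0.
  lra.
rewrite exchange_big/=.
apply: (@le_lt_trans _ _ (\sum_(K <= j < K') 8 * 4^-1 ^+ j)).
  apply: ler_sum => j _.
  rewrite /beta -mulr_sumr.
  have finj i : leb R (`]c i, d i[%classic `&` V j) \is a fin_num.
    rewrite ge0_fin_numE; last exact: outer_measure_ge0.
    have [_ cdi _] := cd i.
    apply: le_lt_trans (ltry (d i - c i)); rewrite -(leb_oo (ltW cdi)).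
    by apply: le_outer_measure; exact: subIsetl.
  have mI i : measurable (`]c i, d i[%classic `&` V j : set (lebesgueR R)).
    apply: measurableI; last exact: measurable_cylinders.
    by apply: borel_leb; exact: measurable_itv.
  have sumle : \sum_(i < n) fine (leb R (`]c i, d i[%classic `&` V j)) <= 2 ^+ j * L j.
    rewrite -lee_fin -sumEFin.
    rewrite (eq_bigr (fun i => leb R (`]c i, d i[%classic `&` V j))); last first.
      by move=> i _; rewrite fineK.
    rewrite -measure_bigsetU_ord.
    - apply: le_trans (leb_cylinders Lpos j); apply: le_outer_measure.
      apply: (big_ind (fun A : set R => A `<=` V j)) => //.
        by move=> A B AV BV z [/AV|/BV].
    - exact: mI.
    - by move=> i1 i2 _ _ [z [[z1 _] [z2 _]]]; apply: tcd => //; exists z.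
  apply: (@le_trans _ _ (8^-1 ^+ j * (8 / L j) * (2 ^+ j * L j))).
    by rewrite ler_wpM2l// mulr_ge0 ?exprn_ge0 ?divr_ge0// ltW.
  rewrite (_ : _ * (2 ^+ j * L j) = 8 * (8^-1 * 2) ^+ j).
    by rewrite (_ : 8^-1 * 2 = 4^-1 :> R)//; lra.
  by rewrite exprMn; field; rewrite gt_eqF.
have geo : \sum_(K <= j < K') 8 * 4^-1 ^+ j <= 16 * 4^-1 ^+ K - 16 * 4^-1 ^+ (maxn K K') :> R.
  have [K'K|KK'] := leqP K' K; first by rewrite big_geq// subrr.
  have {KK'} : (K <= K')%N by exact: ltnW.
  elim: K' => [|m IH]; first by rewrite leqn0 => /eqP ->; rewrite big_geq// subrr.
  rewrite leq_eqVlt => /predU1P[<-|Km]; first by rewrite big_geq// subrr.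
  rewrite big_nat_recr//=; have := IH Km; rewrite exprS.
  have : 0 <= 4^-1 ^+ m :> R by rewrite exprn_ge0//; lra.
  lra.
apply: le_lt_trans geo _.
have : 0 <= 4^-1 ^+ maxn K K' :> R by rewrite exprn_ge0//; lra.
lra.
Qed.

Definition spikes_slope_fun x : R := xget 0 [set alpha | has_slope F x alpha].

Lemma spikes_slope_funP x s : gap L s x -> has_slope F x (spikes_slope_fun x).
Proof.
move=> sx; have [alpha H] := spikes_slope Lpos Lsmall sx.
exact: (@xgetI _ _ _ alpha H).
Qed.

Lemma spikes_HK : HK_integrable r 0 1 spikes_slope_fun.
Proof.
exists F, (cantor_set L); split.
- by apply: memL_spikes => //; exact: le_trans ler01 r1.
- split; last exact: cantor_set_negligible.
  move=> x /(_ 0%N); rewrite word_union0 /cylinder/= !in_itv/=.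
  by rewrite /word_point big_ord0 L0 add0r.
- move=> x [x01 nCx].
  have x0 : cylinder L [::] x by rewrite /cylinder /word_point big_ord0 /= L0 add0r.
  have [//|[s sx]] := cantor_or_gap x0.
  apply: slope_Lderiv => //; first exact: spikes_measurable.
  exact: spikes_slope_funP sx.
- exact: spikes_AC.
Qed.
End HK.

(** * No pair of a major and a minor function *)

Lemma countable_setU (T : choiceType) (A B : set T) :
  countable A -> countable B -> countable (A `|` B).
Proof.
move=> cA cB; rewrite (_ : A `|` B = \bigcup_(b in [set: bool]) (if b then A else B)).
  apply: bigcup_countable; first exact: finite_set_countable.
  by case.
apply/seteqP; split=> x; first by case=> Ax; [exists true|exists false].
by move=> [[] _ Ax]; [left|right].
Qed.

Section Baire.
Context {R : realType} (L : nat -> R) (Lpos : forall k, 0 < L k)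
  (Lsmall : forall k, 8 * L k.+1 <= L k).

(** Nested cylinders chosen to avoid the sets A n in turn have a common point.
Appending one letter at each step makes their stages tend to infinity, so the
common point lies in the Cantor set. *)
Lemma cantor_baire (A : nat -> set R) :
  (forall n s, exists t, forall x, cylinder L (s ++ t) x -> ~ A n x) ->
  exists x, cantor_set L x /\ forall n, ~ A n x.
Proof.
move=> dodge.
have /choice[ext Hext] : forall ns : nat * seq bool, exists t,
    forall x, cylinder L (ns.2 ++ t) x -> ~ A ns.1 x by move=> [n s]; exact: dodge.
pose w := fix w n := if n is n'.+1 then rcons (w n' ++ ext (n', w n')) true else [::].
have sub n m : (n <= m)%N -> cylinder L (w m) `<=` cylinder L (w n).
  elim: m => [|m IH]; first by rewrite leqn0 => /eqP ->.
  rewrite leq_eqVlt => /predU1P[->//|]; rewrite ltnS => /IH H x /= wx.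
  by apply: H; apply: (cylinder_cat Lpos Lsmall) (cylinder_rcons Lpos Lsmall wx).
have size_w n : (n <= size (w n))%N.
  by elim: n => //= n IH; rewrite size_rcons size_cat ltnS (leq_trans IH)// leq_addr.
have pt_in s : cylinder L s (word_point L s).
  by rewrite /cylinder/= in_itv/= lexx lerDl ltW.
pose p n := word_point L (w n).
have p_le n m : p m <= p n + L (size (w n)).
  have [nm|/ltnW mn] := leqP n m.
    by have := sub n m nm _ (pt_in (w m)); rewrite /cylinder/= in_itv/= => /andP[].
  have := sub m n mn _ (pt_in (w n)); rewrite /cylinder/= in_itv/= => /andP[mn' _].
  by apply: le_trans mn' _; rewrite lerDl ltW.
pose x := sup (range p).
have hs : has_sup (range p).
  split; first by exists (p 0%N); exists 0%N.
  by exists (p 0%N + L (size (w 0%N))) => _ [m _ <-]; exact: p_le.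
have wx n : cylinder L (w n) x.
  rewrite /cylinder/= in_itv/=; apply/andP; split.
    by apply: ub_le_sup; [exact: hs.2|exists n].
  by apply: ge_sup; [exact: hs.1|move=> _ [m _ <-]; exact: p_le].
exists x; split=> [k|n].
  exists (take k (w k)); first by rewrite /= size_takel.
  exact: (cylinder_take Lpos Lsmall).
by apply: (Hext (n, w n)) => /=; exact: (cylinder_rcons Lpos Lsmall (wx n.+1)).
Qed.

(** A countable set is avoided along with the sets A n: at step n one of the two
children of the current cylinder misses its n-th point. *)
Lemma cantor_baire_countable (A : nat -> set R) (C : set R) : countable C ->
  (forall x, cantor_set L x -> ~ C x -> exists n, A n x) ->
  exists n s, forall t, exists2 x, cylinder L (s ++ t) x & A n x.
Proof.
move=> /countable_injP[f finj] AC; apply: contrapT => none.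
have [|x [Cx nAx]] := cantor_baire (A := fun n => A n `|` (C `&` f @^-1` [set n])).
  move=> n s.
  have [b Hb] : exists b, forall x, cylinder L (rcons s b) x ->
      ~ (C `&` f @^-1` [set n]) x.
    apply: contrapT => nb.
    have ex b : exists2 x, cylinder L (rcons s b) x & (C `&` f @^-1` [set n]) x.
      apply: contrapT => H; apply: nb; exists b => x bx Cx; apply: H; by exists x.
    have [x x0 [Cx fx]] := ex false; have [y y1 [Cy fy]] := ex true.
    have xy : x = y by apply: finj; rewrite ?inE//; rewrite fx fy.
    rewrite -xy in y1.
    have /rcons_inj[] // : rcons s false = rcons s true.
    by apply: cylinder_inj x0 y1; rewrite ?size_rcons.
  have [t Ht] : exists t, forall x, cylinder L (rcons s b ++ t) x -> ~ A n x.
    apply: contrapT => nt; apply: none; exists n, (rcons s b) => t.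
    apply: contrapT => H; apply: nt; exists t => x tx Ax; apply: H; by exists x.
  exists (b :: t) => x; rewrite -cat_rcons => tx [Ax|]; first exact: Ht tx Ax.
  by apply: Hb; exact: (cylinder_cat Lpos Lsmall) tx.
have [Cx'|/(AC x Cx)[n Ax]] := pselect (C x).
  by apply: (nAx (f x)); right.
by apply: (nAx n); left.
Qed.
End Baire.

(** The number n serves both as a slope and as the inverse of a window size, so
that a point with a right_L1_bound satisfies the condition for all large n. *)
Definition uniform_bound (R : realType) (g : R -> R) (n : nat) (x : R) : Prop :=
  forall h : R, 0 < h -> h < n.+1%:R^-1 -> x + h <= 1 ->
    Int x (x + h) (fun y => Num.max (g y - g x - n%:R * (y - x)) 0) <= h ^+ 2.

Lemma right_L1_bound_uniform (R : realType) (g : R -> R) (x alpha : R) :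
  0 <= x -> itg 0 1 g -> right_L1_bound 1 g x alpha ->
  exists n0, forall n, (n0 <= n)%N -> uniform_bound g n x.
Proof.
move=> x0 ig Hg; have [d d0 Hd] := Hg 1 ltr01.
exists (Num.truncn (`|alpha| + d^-1)).+1 => n nn h h0 hn xh.
have nb : `|alpha| + d^-1 < n%:R.
  by apply: lt_le_trans (truncnS_gt _) _; rewrite ler_nat.
have d'0 : 0 < d^-1 by rewrite invr_gt0.
have hd : h < d.
  apply: lt_trans hn _; rewrite -[ltRHS]invrK ltf_pV2 ?posrE//.
  by rewrite -natr1; have := normr_ge0 alpha; lra.
have := Hd (x + h); rewrite ltrDl h0 ltrD2l hd /= => /(_ isT xh).
rewrite mul1r (_ : x + h - x = h); last by ring.
apply: le_trans; have {}ig := itgS x0 xh ig.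
apply: Int_le; [exact: itg_rb..|move=> z /andP[xz _]].
apply: le_max2 => //; rewrite lerD2l lerN2 ler_wpM2r ?subr_ge0//.
by have := ler_norm alpha; lra.
Qed.

Section NotPerron.
Context {R : realType} (L : nat -> R) (L0 : L 0%N = 1) (Lpos : forall k, 0 < L k)
  (Lsmall : forall k, 8 * L k.+1 <= L k)
  (Lsq : forall e, 0 < e -> exists K, forall k, (K <= k)%N -> L k ^+ 2 <= e * L k.+1).

Let f := spikes_slope_fun L.

(** The window [x, x + 3/4 L k] reaches beyond the spike of gap w and stays in
cylinder w.  On it the total excess of m over m x and that of M x over M are at
most (L k)^2, so m y - m x is small at some y in the core of the spike, and
M x - M z is small at some z of the gap before the spike. *)
Lemma jump_in_cylinder (M m : R -> R) (n : nat) : itg 0 1 m -> itg 0 1 M ->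
  (forall s z y, gap L s z -> gap L s y -> z <= y ->
     spikes L y - spikes L z <= M y - M z) ->
  exists K, forall w, (K <= size w)%N -> forall x, cylinder L (rcons w false) x ->
    uniform_bound m n x -> uniform_bound (fun y => - M y) n x ->
    exists2 y, cylinder L w y & x <= y /\ M x - m x + 4^-1 <= M y - m y.
Proof.
move=> im iM gapM.
(* the three losses below are at most 4 e, 2 e and n e / 4, in sum 1/4 *)
pose e : R := (24 + n%:R)^-1.
have n0 : 0 <= n%:R :> R by [].
have e0 : 0 < e by rewrite invr_gt0; lra.
have [K HK] := Lsq e0; exists K => w Kw x wx bm bM.
have Lk2 := HK _ Kw; set k := size w in Kw Lk2 *.
have Lk := Lpos k; have Lk1 := Lpos k.+1; have Lsm := Lsmall k.
set p := word_point L w.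
have Lke : L k <= e / 8.
  rewrite -(ler_pM2r Lk); move: Lk2; rewrite expr2; have := ler_wpM2l (ltW e0) Lsm; lra.
have : cylinder L [::] (p + L k).
  apply: (@cylinder_cat _ L Lpos Lsmall [::] w).
  by rewrite /cylinder/= in_itv/= lexx andbT lerDl ltW.
have : cylinder L [::] p.
  apply: (@cylinder_cat _ L Lpos Lsmall [::] w).
  by rewrite /cylinder/= in_itv/= lexx lerDl ltW.
rewrite /cylinder /word_point big_ord0/= !in_itv/= L0 add0r => /andP[p0 _] /andP[_ p1].
have /andP[px xp] : p <= x <= p + L k.+1.
  by move: wx; rewrite /cylinder/= in_itv/= word_point_rcons size_rcons mul0r addr0.
pose h := 3 / 4 * L k.
have h0 : 0 < h by rewrite /h; lra.
have hn : h < n.+1%:R^-1.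
  apply: (@le_lt_trans _ _ e); first by rewrite /h; lra.
  by rewrite /e ltf_pV2 ?posrE// -?natr1; lra.
have xh : x + h <= 1 by rewrite /h; lra.
have x0 : 0 <= x by lra.
have h2 : h ^+ 2 <= L k ^+ 2 by rewrite /h; nra.
have {}im := itgS x0 xh im; have {}iM := itgN (itgS x0 xh iM).
have [z /andP[zl zr] Mz] : exists2 z, p + L k / 4 <= z <= p + L k / 4 + L k / 16 &
    Num.max (- M z - - M x - n%:R * (z - x)) 0 <= 32 * L k.
  apply: Int_chebyshev (itg_rb x n%:R iM) _ _ => //.
  - lra.
  - lra.
  - by rewrite /h; lra.
  - by move=> y _; have [] := pos_ge (- M y - - M x - n%:R * (y - x)).
  apply: le_lt_trans (bM h h0 hn xh) _; apply: le_lt_trans h2 _.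
  by rewrite expr2; have := mulr_gt0 Lk Lk; lra.
have [y /andP[yl yr] my] : exists2 y,
    midgap L w - L k.+1 / 2 <= y <= midgap L w + L k.+1 / 2 &
    Num.max (m y - m x - n%:R * (y - x)) 0 <= 2 * (L k ^+ 2 / L k.+1).
  rewrite /midgap -/k -/p.
  apply: Int_chebyshev (itg_rb x n%:R im) _ _ => //.
  - lra.
  - lra.
  - by rewrite /h; lra.
  - by move=> z' _; have [] := pos_ge (m z' - m x - n%:R * (z' - x)).
  apply: le_lt_trans (bm h h0 hn xh) _; apply: le_lt_trans h2 _.
  rewrite (_ : 2 * _ * _ = 2 * L k ^+ 2); last by field; rewrite gt_eqF.
  by rewrite expr2; have := mulr_gt0 Lk Lk; lra.
have [mM1 _] := pos_ge (- M z - - M x - n%:R * (z - x)).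
have [mm1 _] := pos_ge (m y - m x - n%:R * (y - x)).
move: yl yr; rewrite /midgap -/k -/p => yl yr.
have gz : gap L w z by rewrite /gap/= in_itv/= -/k -/p; apply/andP; split; lra.
have gy : gap L w y by rewrite /gap/= in_itv/= -/k -/p; apply/andP; split; lra.
have Fz : spikes L z = 0.
  apply: (spikes_gap0 Lpos Lsmall gz); rewrite /spike /midgap/= in_itv/= -/k -/p.
  by move=> /andP[? ?]; lra.
have Fy : 2^-1 <= spikes L y.
  apply: (spikes_half Lpos Lsmall (s := w)); rewrite /midgap -/k -/p.
  by rewrite ler_norml; apply/andP; split; lra.
have zy : z <= y by lra.
have := gapM w z y gz gy zy; rewrite Fz subr0 => FM.
exists y; first exact: (gap_cylinder Lpos gy).
split; first lra.
have nz : n%:R * (z - x) <= n%:R * L k by rewrite ler_wpM2l//; lra.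
have ny : n%:R * (y - x) <= n%:R * L k by rewrite ler_wpM2l//; lra.
have q : L k ^+ 2 / L k.+1 <= e by rewrite ler_pdivrMr.
have nL : n%:R * L k <= n%:R * (e / 8) by rewrite ler_wpM2l.
have ne : (24 + n%:R) * e = 1 by rewrite /e divff// gt_eqF//; lra.
lra.
Qed.

(** The jumps are collected in the disjoint cylinders rcons (u i) true, where u i
is a fixed word followed by letters false: these march to the left, towards the
left end of the cylinder named by that word. *)
Lemma not_both_minor (s : R) (M m : R -> R) : 1 <= s ->
  minor_function s 0 1 f m -> minor_function s 0 1 (fun x => - f x) (fun x => - M x) ->
  False.
Proof.
move=> s1 /(minor_function_L1 ltr01 s1)[im cm [N1 nN1 HN1] [C1 cC1 HC1]].
move=> /(minor_function_L1 ltr01 s1)[iM cM [N2 nN2 HN2] [C2 cC2 HC2]].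
have iM' : itg 0 1 M.
  by have := itgN iM; under [X in itg 0 1 X]eq_fun do rewrite opprK.
have Mm_nondecr x y : 0 <= x -> x <= y -> y <= 1 -> M x - m x <= M y - m y.
  move=> x0 xy y1.
  suff : m y + - M y <= m x + - M x by lra.
  apply: (L1_nonincreasing (g := fun y => m y + - M y) (N := N1 `|` N2) (C := C1 `|` C2) xy).
  - by apply: itgD; exact: itgS x0 y1 _.
  - by apply: L1_continuousD; [exact: itgS x0 y1 _|exact: itgS x0 y1 _|
      exact: L1_continuousS x0 y1 _|exact: L1_continuousS x0 y1 _].
  - exact: negligibleU.
  - exact: countable_setU.
  - move=> z /andP[xz zy] nN e e0; apply: (right_L1_boundS y1).
    have z01 : 0 < z < 1 by apply/andP; split; lra.
    rewrite (_ : e = (f z + e / 2) + (- f z + e / 2)); last by lra.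
    apply: (right_L1_bound_add (a := 0)) => //; first lra.
      by apply: HN1 => //; [by move=> H; apply: nN; left|lra].
    by apply: HN2 => //; [by move=> H; apply: nN; right|lra].
  - move=> z /andP[xz zy] nC.
    have z01 : 0 < z < 1 by apply/andP; split; lra.
    have [|al1 H1] := HC1 z z01; first by move=> H; apply: nC; left.
    have [|al2 H2] := HC2 z z01; first by move=> H; apply: nC; right.
    exists (al1 + al2); apply: (right_L1_boundS y1).
    by apply: (right_L1_bound_add (a := 0)) => //; lra.
have gap01 w z : gap L w z -> 0 < z < 1.
  move=> wz; have Lk1 := Lpos (size w).+1.
  have : cylinder L [::] (word_point L w).
    apply: (@cylinder_cat _ L Lpos Lsmall [::] w).
    by rewrite /cylinder/= in_itv/= lexx lerDl ltW.
  have : cylinder L [::] (word_point L w + L (size w)).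
    apply: (@cylinder_cat _ L Lpos Lsmall [::] w).
    by rewrite /cylinder/= in_itv/= lexx andbT lerDl ltW.
  rewrite /cylinder {2 4}/word_point big_ord0/= !in_itv/= L0 add0r.
  move: wz; rewrite /gap/= in_itv/= => /andP[? ?] /andP[? ?] /andP[? ?].
  by apply/andP; split; lra.
have gapM w z y : gap L w z -> gap L w y -> z <= y ->
    spikes L y - spikes L z <= M y - M z.
  move=> wz wy zy; have /andP[z0 _] := gap01 w z wz; have /andP[_ y1] := gap01 w y wy.
  suff : spikes L y + - M y <= spikes L z + - M z by lra.
  have wt t : z <= t <= y -> gap L w t.
    move: wz wy; rewrite /gap/= !in_itv/= => /andP[? ?] /andP[? ?] /andP[? ?].
    by apply/andP; split; lra.
  have slope t : z <= t <= y -> has_slope (spikes L) t (f t).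
    by move=> /wt; exact: spikes_slope_funP.
  apply: (L1_nonincreasing (g := fun y => spikes L y + - M y) (N := N2) (C := C2) zy) => //.
  - by apply: itgD; [exact: itg_spikes|exact: itgS (ltW z0) (ltW y1) _].
  - apply: L1_continuousD; [exact: itg_spikes|exact: itgS (ltW z0) (ltW y1) _| |
      exact: L1_continuousS (ltW z0) (ltW y1) _].
    apply: L1_continuous_of_continuous; first exact: itg_spikes.
    move=> t tzy e e0.
    have /cvgrPdistC_le/(_ e e0)/nbhs_ballP[d /= d0 Hd] := has_slope_continuous (slope t tzy).
    by exists d => // u _ ut; apply: Hd; rewrite /ball/= distrC.
  - move=> t /andP[zt ty] nN e e0; apply: (right_L1_boundS (ltW y1)).
    have t01 : 0 < t < 1 by apply/andP; split; lra.
    have tzy : z <= t <= y by apply/andP; split; lra.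
    rewrite (_ : e = (f t + e / 2) + (- f t + e / 2)); last by lra.
    apply: (right_L1_bound_add (a := 0)) => //; [lra|exact: itg_spikes| |].
      by apply: (has_slope_right_L1_bound _ (slope t tzy)); lra.
    by apply: HN2 => //; lra.
  - move=> t /andP[zt ty] nC.
    have t01 : 0 < t < 1 by apply/andP; split; lra.
    have tzy : z <= t <= y by apply/andP; split; lra.
    have [al2 H2] := HC2 t t01 nC.
    exists (f t + 1 + al2); apply: (right_L1_boundS (ltW y1)).
    apply: (right_L1_bound_add (a := 0)) => //; [lra|exact: itg_spikes|].
    by apply: (has_slope_right_L1_bound _ (slope t tzy)); lra.
pose Good n := [set x | uniform_bound m n x /\ uniform_bound (fun y => - M y) n x].
have cC : countable (C1 `|` C2 `|` [set 0; 1]).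
  by apply: countable_setU; [exact: countable_setU|exact/finite_set_countable].
have [n [s0 dense]] : exists n s, forall t, exists2 x, cylinder L (s ++ t) x & Good n x.
  apply: (cantor_baire_countable Lpos Lsmall cC) => x Cx nC.
  have x01 : 0 < x < 1.
    have := Cx 0%N; rewrite word_union0 /cylinder /word_point big_ord0/= in_itv/= L0 add0r.
    move=> /andP[x0 x1]; rewrite !lt_neqAle x0 x1 !andbT; apply/andP; split.
      by apply/eqP => x0'; apply: nC; right; left.
    by apply/eqP => x0'; apply: nC; right; right.
  have x0 : 0 <= x by case/andP: x01 => /ltW.
  have [|al1 /(right_L1_bound_uniform x0 im)[n1 H1]] := HC1 x x01.
    by move=> H; apply: nC; left; left.
  have [|al2 /(right_L1_bound_uniform x0 iM)[n2 H2]] := HC2 x x01.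
    by move=> H; apply: nC; left; right.
  by exists (maxn n1 n2); split; [apply: H1; exact: leq_maxl|apply: H2; exact: leq_maxr].
have [K HK] := jump_in_cylinder n im iM' gapM.
pose u i := s0 ++ nseq (K + i) false.
have uS i : u i.+1 = rcons (u i) false by rewrite /u addnS -addn1 nseqD catA cats1.
pose right_end i := word_point L (u i) + L (size (u i)).
have u01 i x : cylinder L (u i) x -> 0 <= x <= 1.
  move=> /(@cylinder_cat _ L Lpos Lsmall [::] (u i)).
  by rewrite /cylinder /word_point big_ord0/= in_itv/= L0 add0r.
have re_in i : cylinder L (u i) (right_end i).
  by rewrite /cylinder/= in_itv/= lexx andbT lerDl ltW.
have step i : M (right_end i.+1) - m (right_end i.+1) + 4^-1 <=
    M (right_end i) - m (right_end i).
  pose w := rcons (u i) true.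
  have [x wx [gm gM]] : exists2 x, cylinder L (rcons w false) x & Good n x.
    by have := dense (rcons (rcons (nseq (K + i) false) true) false); rewrite -!rcons_cat.
  have Kw : (K <= size w)%N by rewrite size_rcons size_cat size_nseq; lia.
  have [y wy [xy jump]] := HK w Kw x wx gm gM.
  have {}wx := cylinder_rcons Lpos Lsmall wx.
  have /andP[x0 _] := u01 i x (cylinder_rcons Lpos Lsmall wx).
  have /andP[_ y1] := u01 i y (cylinder_rcons Lpos Lsmall wy).
  have /andP[r0 _] := u01 i.+1 _ (re_in i.+1).
  have /andP[_ r1] := u01 i _ (re_in i).
  move: wx wy; rewrite /w /cylinder/= !in_itv/= word_point_rcons size_rcons mul1r.
  move=> /andP[lx _] /andP[_ uy].
  have rx : right_end i.+1 <= x.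
    rewrite /right_end uS word_point_rcons size_rcons mul0r addr0.
    by have := Lsmall (size (u i)); have := Lpos (size (u i)).+1; lra.
  have yr : y <= right_end i by rewrite /right_end; lra.
  have := Mm_nondecr _ _ r0 rx (le_trans xy y1).
  have := Mm_nondecr _ _ (le_trans x0 xy) yr r1.
  lra.
have desc i : M (right_end i) - m (right_end i) + i%:R / 4 <=
    M (right_end 0%N) - m (right_end 0%N).
  elim: i => [|i IH]; first by rewrite mul0r addr0.
  by have := step i; rewrite (_ : i.+1%:R = i%:R + 1 :> R) ?natr1//; lra.
pose T := (M (right_end 0%N) - m (right_end 0%N) - (M 0 - m 0)) * 4.
have [N TN] : exists N : nat, T < N%:R.
  by exists (Num.truncn `|T|).+1; apply: le_lt_trans (ler_norm _) (truncnS_gt _).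
have /andP[rN0 rN1] := u01 _ _ (re_in N).
have := Mm_nondecr _ _ (lexx _) rN0 rN1.
by have := desc N; move: TN; rewrite /T; lra.
Qed.
End NotPerron.

Theorem corollary1 (R : realType) (r : R) (hr : 1 <= r) :
  exists (a b : R) (f : R -> R),
    [/\ a < b,
        HK_integrable r a b f &
        forall s : R, 1 <= s -> ~ P_integrable s a b f].
Proof.
have [L [L0 Lpos Lsmall Lavg Lsq]] := exists_scales hr.
exists 0, 1, (spikes_slope_fun L); split; first exact: ltr01.
  exact: spikes_HK.
move=> s s1 Pf; have [M [m [majM minm _]]] := Pf 1 ltr01.
exact: (not_both_minor L0 Lpos Lsmall Lsq s1 minm majM).
Qed.
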